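(* Let $m,n$ be positive integers, let $K$ be an infinite field and let $S=K[x_{ij} : 1\le i\le m,\ 1\le j\le n]$ with the $\mathbb{Z}^m$-grading $\deg x_{ij}=e_i$. Let $L=(\ell_{ij})$ be an $m\times n$ matrix whose entries are linear forms with $\ell_{ij}\in S_{e_i}$ (possibly zero), and let $I_2(L)$ be the ideal of $S$ generated by the $2$-minors of $L$. For $i\in[m]=\{1,\dots,m\}$ let $V_i=\{\lambda\in K^n : \sum_{j=1}^n\lambda_j\ell_{ij}=0\}$, and for $A\subseteq [m]$ let $V_A=\sum_{i\in A}V_i\subseteq K^n$. Then: (1) $I_2(L)$ is a Cartwright-Sturmfels ideal. (2) The multigraded generic initial ideal $\operatorname{gin}(I_2(L))$ is generated by the monomials of the form $\prod_{i\in A}x_{ib_i}$ such that $A\subseteq[m]$, $1\leq b_i\leq n-\dim_K V_i$ for every $i\in A$, and $$\sum_{i\in A}b_i\leq n(|A|-1)+\dim_K V_A-\sum_{i\in A}\dim_K V_i .$$ (3) The irredundant prime decomposition of $\operatorname{gin}(I_2(L))$ is given by $$\operatorname{gin}(I_2(L))=\bigcap_v P_v,$$ where $v=(v_1,\dots,v_m)$ varies among the vectors of $\mathbb{N}^m$ satisfying the following conditions, with $A=\{i\in[m] : v_i<n-\dim_K V_i\}$: $0\leq v_i\leq n-\dim_K V_i$ for every $i=1,\dots,m$; $\displaystyle\sum_{i=1}^m v_i=n(m-1)+1-|A|+\dim_K V_A-\sum_{i=1}^m\dim_K V_i$; $\dim_K V_B>\dim_K V_A$ for every $B$ with $A\subsetneq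 B\subseteq [m]$.
   Context: $\mathbb{N}$ includes $0$; $e_1,\dots,e_m$ is the canonical basis of $\mathbb{Z}^m$, and $S_{e_i}$ is the space of homogeneous elements of degree $e_i$. For $v\in\mathbb{N}^m$ with $v_i\le n$, $P_v=(x_{ij} : 1\leq i\leq m,\ 1\leq j\leq v_i)$. Group actions: $G=\mathrm{GL}_n(K)^m$ acts on $S$ by $\mathbb{Z}^m$-graded $K$-algebra automorphisms, the $i$-th factor acting linearly on $\langle x_{i1},\dots,x_{in}\rangle$. The Borel subgroup $B_G\subset G$ consists of the $m$-tuples of invertible upper triangular matrices, i.e. of the elements $g$ such that $g(x_{ij})\in\langle x_{i1},\dots,x_{ij}\rangle$ for all $i,j$. An ideal $J$ is Borel fixed if $g(J)=J$ for all $g\in B_G$. Generic initial ideals: term orders $\tau$ on $S$ are always assumed to satisfy $x_{ij}>x_{ik}$ for $j<k$. For a $\mathbb{Z}^m$-graded ideal $I$, the multigraded generic initial ideal is $\operatorname{gin}_\tau(I)=\operatorname{in}_\tau(g(I))$ for a general $g\in G$ (i.e. $g$ in a suitable nonempty Zariski open subset of $G$). A $\mathbb{Z}^m$-graded ideal $I$ of $S$ is Cartwright-Sturmfels if there exists a radical Borel fixed ideal $J$ of $S$ with the same $\mathbb{Z}^m$-graded Hilbert series as $I$. It is known that for such an ideal $\operatorname{gin}_\tau(I)$ does not depend on $\tau$; it is denoted $\operatorname{gin}(I)$. Irredundant means that no $P_v$ in the list can be omitted from the intersection.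
   Formalization: Part (3) is proved under the extra assumption that L is nonzero or n = 1; for L = 0 and n ≥ 2 it fails as stated, since no v satisfies the conditions (the sum would have to be 1 − n) while gin(I_2(L)) = 0. *)

(* Defs.v *)
From mathcomp Require Export all_boot all_order all_algebra.
From mathcomp Require Export mpoly.

Set Implicit Arguments.
Unset Strict Implicit.
Unset Printing Implicit Defensive.

Import Order.TTheory GRing.Theory Num.Theory.
Local Open Scope ring_scope.

Definition infinite_field (K : fieldType) : Prop :=
  forall s : seq K, exists x : K, x \notin s.

(* Subsets of a ring are Prop-valued: MathComp's own ideals are boolean
   predicates, hence assume decidable membership. *)
Section Ideals.
Variable R : comNzRingType.
Implicit Types I J E : R -> Prop.

Definition same_set I J : Prop := forall f, I f <-> J f.

Definition is_ideal I : Prop :=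
  [/\ I 0, forall f g, I f -> I g -> I (f + g) & forall c f, I f -> I (c * f)].

Definition gen_ideal E : R -> Prop := fun f =>
  exists k (c g : 'I_k -> R),
    (forall a, E (g a)) /\ f = \sum_(a < k) c a * g a.

Definition radical_ideal I : Prop :=
  is_ideal I /\ forall f k, I (f ^+ k) -> I f.

Definition prime_ideal I : Prop :=
  [/\ is_ideal I, ~ I 1 & forall f g, I (f * g) -> I f \/ I g].

Definition bigcap_ideal (T : Type) (D : T -> Prop) (P : T -> R -> Prop) :
  R -> Prop := fun f => forall v, D v -> P v f.

(* If D is empty, the intersection is the whole ring.  For I_2(L) this would
   happen exactly when L = 0 and n > 1: then V_i = K^n for all i, so v = 0,
   whereas the required value of sum_i v_i is 1 - n. *)
Definition irredundant_prime_decomposition (T : Type) (D : T -> Prop)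
    (P : T -> R -> Prop) J : Prop :=
  [/\ forall v, D v -> prime_ideal (P v),
      same_set J (bigcap_ideal D P)
    & forall w, D w ->
        ~ same_set J (bigcap_ideal (fun v => D v /\ v <> w) P)].

Definition minor_of (m n t : nat) (L : 'M[R]_(m, n)) : R -> Prop := fun p =>
  exists (f : 'I_t -> 'I_m) (g : 'I_t -> 'I_n),
    [/\ forall a b : 'I_t, (a < b)%N -> (f a < f b)%N,
        forall a b : 'I_t, (a < b)%N -> (g a < g b)%N
      & p = \det (mxsub f g L)].

Definition minors_ideal (m n t : nat) (L : 'M[R]_(m, n)) : R -> Prop :=
  gen_ideal (minor_of t L).

End Ideals.

(* S = K[x_ij] is {mpoly K[m * n]}; x_ij is the variable of index
   mxvec_index i j.  Ordinals start at 0, so x_ij of the mathematical text has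
   here the column index j - 1. *)
Section Multigraded.
Variables (m n : nat) (K : fieldType).
Local Notation S := {mpoly K[m * n]}.
Local Notation mon := 'X_{1.. m * n}.
(* Degrees range over N^m, since S_d = 0 for the other d in Z^m. *)
Local Notation degree := {ffun 'I_m -> nat}.
Implicit Types (I J : S -> Prop) (f : S) (u w : mon) (d : degree).

Definition xvar (i : 'I_m) (j : 'I_n) : S := 'X_(mxvec_index i j).

Definition unit_degree (i : 'I_m) : degree := [ffun k => (k == i) : nat].

Definition mon_degree u : degree :=
  [ffun i => (\sum_(j < n) u (mxvec_index i j))%N].

Definition homogeneous d f : Prop :=
  forall u, u \in msupp f -> mon_degree u = d.

Definition hom_component d f : S :=
  \sum_(u <- msupp f | mon_degree u == d) f@_u *: 'X_[u].

Definition multigraded I : Prop :=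
  is_ideal I /\ forall f d, I f -> I (hom_component d f).

(* dim_K (S/I)_d = r: some r elements of S_d form a basis of S_d modulo I. *)
Definition hilbert_coef I d (r : nat) : Prop :=
  exists b : 'I_r -> S,
    [/\ forall a, homogeneous d (b a),
        forall c : 'I_r -> K,
          I (\sum_(a < r) c a *: b a) -> forall a, c a = 0
      & forall f, homogeneous d f ->
          exists c : 'I_r -> K, I (f - \sum_(a < r) c a *: b a)].

Definition same_hilbert_series I J : Prop :=
  forall d r, hilbert_coef I d r <-> hilbert_coef J d r.

Definition in_G (g : 'I_m -> 'M[K]_n) : Prop := forall i, g i \in unitmx.

Definition in_borel (g : 'I_m -> 'M[K]_n) : Prop :=
  in_G g /\ forall i (k j : 'I_n), (j < k)%N -> g i k j = 0.

Definition act (g : 'I_m -> 'M[K]_n) f : S :=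
  f \mPo [tuple mxvec (\matrix_(i, j) \sum_(k < n) g i k j *: xvar i k) 0 q
         | q < m * n].

Lemma act_xvar g i j : act g (xvar i j) = \sum_(k < n) g i k j *: xvar i k.
Proof. by rewrite /act /xvar comp_mpolyXU -tnth_nth tnth_mktuple mxvecE mxE. Qed.

Definition act_ideal g I : S -> Prop := fun h => exists2 f, I f & h = act g f.

Definition borel_fixed J : Prop :=
  forall g, in_borel g -> same_set (act_ideal g J) J.

Definition cartwright_sturmfels I : Prop :=
  multigraded I /\
  exists J, [/\ multigraded J, radical_ideal J, borel_fixed J
              & same_hilbert_series I J].

(* tau u w reads: u is smaller than or equal to w. *)
Definition term_order (tau : rel mon) : Prop :=
  [/\ [/\ reflexive tau, antisymmetric tau, transitive tau & total tau],
      forall u, tau 0%MM u,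
      forall u v w, tau u v -> tau (u + w)%MM (v + w)%MM
    & forall i (j k : 'I_n), (j < k)%N ->
        tau U_(mxvec_index i k)%MM U_(mxvec_index i j)%MM].

Definition leading_mon (tau : rel mon) f u : Prop :=
  u \in msupp f /\ forall w, w \in msupp f -> tau w u.

Definition initial_ideal (tau : rel mon) I : S -> Prop :=
  gen_ideal (fun p => exists f u, [/\ I f, leading_mon tau f u & p = 'X_[u]]).

Definition coord (g : 'I_m -> 'M[K]_n) (q : 'I_#|{: 'I_m * 'I_n * 'I_n}|) : K :=
  let: (i, k, j) := enum_val q in g i k j.

Definition zariski_open_in_G (U : ('I_m -> 'M[K]_n) -> Prop) : Prop :=
  exists E : {mpoly K[#|{: 'I_m * 'I_n * 'I_n}|]} -> Prop,
    forall g, U g <-> in_G g /\ exists2 F, E F & F.@[coord g] != 0.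

(* J = gin_tau(I).  Over an infinite field two nonempty open subsets of G meet,
   so J is determined by tau and I. *)
Definition is_gin (tau : rel mon) I J : Prop :=
  exists U, [/\ zariski_open_in_G U, exists g, U g
              & forall g, U g ->
                  same_set (initial_ideal tau (act_ideal g I)) J].

Definition P_ideal (v : degree) : S -> Prop :=
  gen_ideal (fun p => exists (i : 'I_m) (j : 'I_n), (j < v i)%N /\ p = xvar i j).

(* V_i, the space of linear relations on the i-th row of L; it is computed from
   coefficients, which is justified by mem_relspace below when the entries of
   the row have degree e_i. *)
Definition relspace (L : 'M[S]_(m, n)) (i : 'I_m) : {vspace 'rV[K]_n} :=
  lker (linfun (mulmxr (\matrix_(j < n, k < n) (L i j)@_U_(mxvec_index i k)))).

Lemma linear_formE i f : homogeneous (unit_degree i) f ->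
  f = \sum_(k < n) f@_U_(mxvec_index i k) *: xvar i k.
Proof.
move=> hf; apply/mpolyP=> u; rewrite raddf_sum /=.
under eq_bigr => k _ do rewrite mcoeffZ mcoeffX.
have [/existsP[k /eqP <-]|/existsPn nu] :=
  boolP [exists k, U_(mxvec_index i k)%MM == u].
  rewrite (bigD1 k) //= eqxx mulr1 big1 ?addr0 // => l nlk.
  case: eqP => [e|]; last by rewrite mulr0.
  have := congr1 (fun w : mon => w (mxvec_index i k)) e.
  rewrite /= !mnm1E eqxx; case: eqP => // /cast_ord_inj /enum_rank_inj [/eqP].
  by rewrite (negPf nlk).
rewrite big1 => [|k _]; last by rewrite (negPf (nu k)) mulr0.
apply/eqP; apply: contraT; rewrite -mcoeff_msupp => /hf du.
have d1 : (\sum_(p < m) \sum_(j < n) u (mxvec_index p j) = 1)%N.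
  have dp p : (\sum_(j < n) u (mxvec_index p j) = (p == i))%N.
    by have /(congr1 (fun h : degree => h p)) := du; rewrite !ffunE.
  by rewrite (bigD1 i) //= dp eqxx big1 // => p /negPf np; rewrite dp np.
have /mdeg1P[q /eqP uq]: mdeg u == 1%N.
  rewrite mdegE -d1 pair_big /= (reindex _ (curry_mxvec_bij m n)) /=.
  by apply/eqP; apply: eq_bigr => -[].
move: nu; rewrite uq; case/mxvec_indexP: q uq => p j uq.
have /(congr1 (fun h : degree => h p)) := du.
rewrite !ffunE uq (bigD1 j) //= mnm1E eqxx.
by case: eqP => [->|//] _ /(_ j); rewrite eqxx.
Qed.

Lemma mem_relspace (L : 'M[S]_(m, n)) i (lam : 'rV[K]_n) :
    (forall j, homogeneous (unit_degree i) (L i j)) ->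
  (lam \in relspace L i) = (\sum_(j < n) lam 0 j *: L i j == 0).
Proof.
move=> hL; rewrite memv_ker lfunE /=.
have E k : (\sum_j lam 0 j *: L i j)@_U_(mxvec_index i k) =
    (lam *m \matrix_(j < n, k < n) (L i j)@_U_(mxvec_index i k)) 0 k.
  rewrite raddf_sum mxE /=; apply: eq_bigr => j _.
  by rewrite mcoeffZ mxE.
apply/eqP/eqP => [e|e]; last by apply/rowP => k; rewrite -E e mcoeff0 mxE.
have h : homogeneous (unit_degree i) (\sum_j lam 0 j *: L i j).
  move=> u /msupp_sum_le /flattenP[_ /mapP[j _ ->]] /msuppZ_le; exact: hL.
by rewrite (linear_formE h) big1 // => k _; rewrite E e mxE scale0r.
Qed.

End Multigraded.

(* Main.v *)
Require Import Defs.
From mathcomp Require Import fingroup perm zify.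

Set Implicit Arguments.
Unset Strict Implicit.
Unset Printing Implicit Defensive.

Import Order.TTheory GRing.Theory Num.Theory.
Local Open Scope ring_scope.

(** Write d_i = n - dim V_i and w_A = n - dim V_A, and let M be the ideal
generated by the monomials listed in (2).  Everything follows from the equality
in_tau(g I_2(L)) = M for every term order tau and every g in general position.

The ideal I_2(L) vanishes on the variety X_A of the points at which the rows of
L outside A are zero and the rows in A are multiples of a single vector
orthogonal to V_A; it is these components that detect the missing monomials.

M is contained in the initial ideal.  Let F_i(b) be the space of the vectors v
in K^n for which the form sum_j v_j l_ij, moved by g, does not involve the first
b variables of its row ([flag]).  The inequality in (2) says that for general g
the spaces F_i(b_i), for i in A, together span K^n.  Choose lambda_i in
F_i(b_i - 1) whose form has leading variable x_{i,b_i}, write lambda_i as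
sum_j p_ij with p_ij in F_j(b_j), and let N be the matrix of vectors
diag(lambda) - p, whose rows sum to 0.  Evaluating column j of N on row j of the
moved L gives a square matrix whose determinant lies in g I_2(L), because its
columns are dependent once the rows of L are proportional
([det_row_form_mx_mem]).  Only the diagonal contributes prod_i x_{i,b_i}, and
all other monomials have larger column indices, so this product is the leading
monomial for every tau ([leading_det_form_mx], [leading_in_minors]).

The initial ideal is contained in M.  Let u be a monomial outside M, and let A
be the set of the rows i in which u has a variable x_ij with j <= d_i.  Then u is
standard for A: with mu_i the first index of u in row i, the sum of d_i - mu_i
over A is less than w_A.  The determinants above, with the condition that the
rows of N sum to 0 relaxed to their sums lying in V_A, make every monomial that
is not standard for A a leading monomial of a polynomial vanishing on g X_A
([leading_vanishing]).  On the other hand no nonzero homogeneous combination of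
standard monomials vanishes on g X_A: cut g X_A with the hyperplane where the
last variable of a row vanishes, and use induction ([window_eq0]).  Dividing an
element of g I_2(L) by the former family leaves a remainder which is zero by the
latter, so that u is not its leading monomial ([leading_not_standard]).

General position means that some minors with entries polynomial in g do not
vanish ([generic_injective_system]).  That this happens for at least one g
comes from shrinking the spaces of columns one dimension at a time, each time
removing a vector of their intersection ([shrink_bigcap]).

The monomials outside M form a basis of S modulo g I_2(L) and modulo M, hence
the Hilbert series agree.  Borel invariance is visible on the generators.  For
(3), the vector s_i = d_i - v_i - 1 turns the conditions on v into the following:
s_i >= 0 exactly on A, the sum of s over A is w_A - 1, and A cannot be enlarged
without decreasing w_A.  A monomial outside M yields such an s above its vector
d_i - mu_i ([facet_cover]); the solutions are incomparable ([facet_antichain]).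
As an intersection of primes, M is radical. *)

(** * Ideals given by generators *)

Section GenIdeal.
Variable R : comNzRingType.
Implicit Types (I J E : R -> Prop).

Lemma ideal_sum I (T : Type) (r : seq T) (P : pred T) (F : T -> R) :
  is_ideal I -> (forall a, P a -> I (F a)) -> I (\sum_(a <- r | P a) F a).
Proof. by case=> I0 ID _ IF; apply: big_ind. Qed.

Lemma idealN I f : is_ideal I -> I f -> I (- f).
Proof. by case=> _ _ IM If; rewrite -mulN1r; apply: IM. Qed.

Lemma gen_ideal_is_ideal E : is_ideal (gen_ideal E).
Proof.
split=> [|f h [k [c [g [Eg ->]]]] [l [d [e [Ee ->]]]]|x f [k [c [g [Eg ->]]]]].
- by exists 0%N, (fun=> 0), (fun=> 0); split=> [[]|] //; rewrite big_ord0.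
- exists (k + l)%N, (fun a => match split a with inl b => c b | inr b => d b end),
    (fun a => match split a with inl b => g b | inr b => e b end).
  split=> [a|]; first by case: split.
  rewrite big_split_ord /=; congr (_ + _); apply: eq_bigr => a _.
    by case: splitP => b /= ab; [rewrite (ord_inj ab) | have := ltn_ord a; lia].
  case: splitP => b /= ab; first by have := ltn_ord b; lia.
  by rewrite (@ord_inj _ a b) //; lia.
- exists k, (fun a => x * c a), g; split=> //.
  by rewrite mulr_sumr; apply: eq_bigr => a _; rewrite mulrA.
Qed.

Lemma mem_gen_ideal E f : E f -> gen_ideal E f.
Proof.
move=> Ef; exists 1%N, (fun=> 1), (fun=> f); split=> //.
by rewrite big_ord1 mul1r.
Qed.

Lemma gen_ideal_min E I f :
  is_ideal I -> (forall g, E g -> I g) -> gen_ideal E f -> I f.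
Proof.
move=> Iid EI [k [c [g [Eg ->]]]]; apply: ideal_sum => // a _.
by case: Iid => _ _; apply; apply: EI.
Qed.

End GenIdeal.

(** * Multidegrees and the action of G *)

Section Homogeneous.
Variables (m n : nat) (K : fieldType).
Local Notation S := {mpoly K[m * n]}.
Local Notation mon := 'X_{1.. m * n}.
Local Notation degree := {ffun 'I_m -> nat}.
Implicit Types (I J : S -> Prop) (f : S) (u w : mon) (d : degree).

Definition add_degree d d' : degree := [ffun i => (d i + d' i)%N].

Lemma mon_degreeD u w :
  mon_degree (u + w)%MM = add_degree (mon_degree u) (mon_degree w).
Proof.
apply/ffunP => i; rewrite !ffunE -big_split; apply: eq_bigr => j _.
by rewrite mnmDE.
Qed.

Lemma mon_degreeU (i : 'I_m) (j : 'I_n) :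
  mon_degree U_(mxvec_index i j)%MM = unit_degree i.
Proof.
apply/ffunP => k; rewrite !ffunE.
have [->|ki] := eqVneq k i.
  rewrite (bigD1 j) //= mnm1E eqxx big1 ?addn0 // => l lj.
  rewrite mnm1E; case: eqP => // /cast_ord_inj /enum_rank_inj [] jl.
  by rewrite jl eqxx in lj.
rewrite big1 // => l _; rewrite mnm1E; case: eqP => //.
by move=> /cast_ord_inj /enum_rank_inj [] ik; rewrite ik eqxx in ki.
Qed.

Lemma homogeneous0 d : homogeneous d (0 : S).
Proof. by move=> u; rewrite msupp0. Qed.

Lemma homogeneousX u : homogeneous (mon_degree u) ('X_[u] : S).
Proof. by move=> w; rewrite msuppX inE => /eqP ->. Qed.

Lemma homogeneousD d f g :
  homogeneous d f -> homogeneous d g -> homogeneous d (f + g).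
Proof. by move=> hf hg u /msuppD_le; rewrite mem_cat => /orP[/hf|/hg]. Qed.

Lemma homogeneousZ d c f : homogeneous d f -> homogeneous d (c *: f).
Proof. by move=> hf u /msuppZ_le /hf. Qed.

Lemma homogeneousB d f g :
  homogeneous d f -> homogeneous d g -> homogeneous d (f - g).
Proof.
by move=> hf hg; rewrite -scaleN1r; apply: homogeneousD => //; apply: homogeneousZ.
Qed.

Lemma homogeneous_sum d (T : Type) (r : seq T) (P : pred T) (F : T -> S) :
  (forall a, P a -> homogeneous d (F a)) ->
  homogeneous d (\sum_(a <- r | P a) F a).
Proof. by move=> hF; apply: big_ind => //; [apply: homogeneous0|apply: homogeneousD]. Qed.

Lemma homogeneousM d d' f g :
  homogeneous d f -> homogeneous d' g -> homogeneous (add_degree d d') (f * g).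
Proof.
move=> hf hg u /msuppM_le /allpairsP[[a b] /= [af bg ->]].
by rewrite mon_degreeD (hf _ af) (hg _ bg).
Qed.

Lemma homogeneous_prod (T : Type) (r : seq T) (D : T -> degree) (F : T -> S) :
  (forall a, homogeneous (D a) (F a)) ->
  homogeneous [ffun i => (\sum_(a <- r) D a i)%N] (\prod_(a <- r) F a).
Proof.
move=> hF; elim: r => [|a r IH].
  rewrite big_nil -mpolyX0 => u; rewrite msuppX inE => /eqP ->.
  by apply/ffunP => i; rewrite !ffunE big_nil big1 // => j _; rewrite mnm0E.
rewrite big_cons; have -> : [ffun i => (\sum_(b <- a :: r) D b i)%N] =
    add_degree (D a) [ffun i => (\sum_(b <- r) D b i)%N].
  by apply/ffunP => i; rewrite !ffunE big_cons.
exact: homogeneousM.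
Qed.

(** Several constructions discard the monomials of a polynomial that fail a test;
this computes the coefficients of what remains. *)
Lemma mcoeff_restrict (P : pred mon) f u :
  (\sum_(w <- msupp f | P w) f@_w *: 'X_[w])@_u = if P u then f@_u else 0.
Proof.
rewrite raddf_sum /=; have [uf|uf] := boolP (u \in msupp f).
  rewrite big_mkcond (bigD1_seq u) ?msupp_uniq //= big1 => [|w wu].
    by rewrite addr0; case: ifP => // _; rewrite mcoeffZ mcoeffX eqxx mulr1.
  by case: ifP => // _; rewrite mcoeffZ mcoeffX (negPf wu) mulr0.
rewrite big1_seq => [|w /andP[_ wf]]; first by rewrite (memN_msupp_eq0 uf) if_same.
rewrite mcoeffZ mcoeffX; case: eqP => [wu|]; last by rewrite mulr0.
by rewrite -wu wf in uf.
Qed.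

Lemma mcoeff_hom_component d f u :
  (hom_component d f)@_u = if mon_degree u == d then f@_u else 0.
Proof. exact: mcoeff_restrict. Qed.

Lemma msupp_hom_component d f u :
  (u \in msupp (hom_component d f)) = (mon_degree u == d) && (u \in msupp f).
Proof.
by rewrite !mcoeff_msupp mcoeff_hom_component; case: (mon_degree u == d); rewrite ?eqxx.
Qed.

Lemma hom_component_homogeneous d f : homogeneous d (hom_component d f).
Proof. by move=> u; rewrite msupp_hom_component => /andP[/eqP]. Qed.

Lemma hom_component_sum d (T : Type) (r : seq T) (P : pred T) (F : T -> S) :
  hom_component d (\sum_(a <- r | P a) F a) =
  \sum_(a <- r | P a) hom_component d (F a).
Proof.
apply/mpolyP => u; rewrite mcoeff_hom_component !raddf_sum /=.
under [RHS]eq_bigr => a _ do rewrite mcoeff_hom_component.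
by case: eqP => // _; rewrite big1.
Qed.

Lemma hom_component_id d d' f : homogeneous d f ->
  hom_component d' f = if d == d' then f else 0.
Proof.
move=> hf; apply/mpolyP => u; rewrite mcoeff_hom_component.
have [uf|uf] := boolP (u \in msupp f).
  by rewrite (hf _ uf); case: eqP; rewrite ?mcoeff0.
by rewrite (memN_msupp_eq0 uf) if_same; case: (d == d');
  rewrite ?mcoeff0 ?(memN_msupp_eq0 uf).
Qed.

Lemma multigraded_gen (E : S -> Prop) :
  (forall p, E p -> exists d, homogeneous d p) -> multigraded (gen_ideal E).
Proof.
move=> hE; have Eid := gen_ideal_is_ideal E; split=> // f d [k [c [g [Eg ->]]]].
rewrite hom_component_sum; apply: ideal_sum => // a _.
have [e he] := hE _ (Eg a).
rewrite {1}(mpolyE (c a)) mulr_suml hom_component_sum; apply: ideal_sum => // u _.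
have hu : homogeneous (add_degree (mon_degree u) e) ((c a)@_u *: 'X_[u] * g a).
  by apply: homogeneousM he; apply: homogeneousZ; apply: homogeneousX.
rewrite (hom_component_id _ hu); case: ifP => _; last by case: Eid.
by case: Eid => _ _; apply; apply: mem_gen_ideal.
Qed.

Section Act.
Variable g : 'I_m -> 'M[K]_n.

Lemma actD f h : act g (f + h) = act g f + act g h.
Proof. exact: comp_mpolyD. Qed.
Lemma actB f h : act g (f - h) = act g f - act g h.
Proof. exact: comp_mpolyB. Qed.
Lemma actM f h : act g (f * h) = act g f * act g h.
Proof. by rewrite /act rmorphM. Qed.
Lemma act0 : act g 0 = 0. Proof. exact: comp_mpoly0. Qed.
Lemma act1 : act g 1 = 1. Proof. exact: comp_mpoly1. Qed.
Lemma actZ c f : act g (c *: f) = c *: act g f.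
Proof. exact: comp_mpolyZ. Qed.

Lemma act_sum (T : Type) (r : seq T) (P : pred T) (F : T -> S) :
  act g (\sum_(a <- r | P a) F a) = \sum_(a <- r | P a) act g (F a).
Proof. by rewrite /act raddf_sum. Qed.

Lemma act_prod (T : Type) (r : seq T) (P : pred T) (F : T -> S) :
  act g (\prod_(a <- r | P a) F a) = \prod_(a <- r | P a) act g (F a).
Proof. by rewrite /act rmorph_prod. Qed.

Lemma act_det k (A : 'M[S]_k) : act g (\det A) = \det (map_mx (act g) A).
Proof.
rewrite /determinant act_sum; apply: eq_bigr => s _.
rewrite actM act_prod; congr (_ * _); last by apply: eq_bigr => i _; rewrite mxE.
by case: odd_perm; rewrite ?expr0 ?expr1 ?act1 // -scaleN1r actZ act1.
Qed.

End Act.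

Lemma homogeneous_xvar (i : 'I_m) (j : 'I_n) : homogeneous (unit_degree i) (xvar K i j).
Proof. by rewrite -(mon_degreeU i j); apply: homogeneousX. Qed.

Lemma act_monomial g u : act g ('X_[u] : S) =
  \prod_(p : 'I_m * 'I_n) act g (xvar K p.1 p.2) ^+ u (mxvec_index p.1 p.2).
Proof.
rewrite {1}mpolyXE_id act_prod (reindex _ (curry_mxvec_bij m n)) /=.
by apply: eq_bigr => -[i j] _; rewrite /= /act rmorphXn.
Qed.

Lemma homogeneous_act g d f : homogeneous d f -> homogeneous d (act g f).
Proof.
move=> hf; rewrite (mpolyE f) act_sum big_seq; apply: homogeneous_sum => u uf.
rewrite actZ; apply: homogeneousZ; rewrite -(hf _ uf) act_monomial.
have hp (p : 'I_m * 'I_n) : homogeneous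
    [ffun i => (\sum_(a < u (mxvec_index p.1 p.2)) unit_degree p.1 i)%N]
    (act g (xvar K p.1 p.2) ^+ u (mxvec_index p.1 p.2)).
  rewrite -[X in _ ^+ X]card_ord -prodr_const; apply: homogeneous_prod => _.
  rewrite act_xvar; apply: homogeneous_sum => k _; apply: homogeneousZ.
  exact: homogeneous_xvar.
have := homogeneous_prod (r := index_enum _) hp; congr (homogeneous _ _).
apply/ffunP => i; rewrite !ffunE -(pair_bigA _ (fun a b =>
  [ffun i0 => (\sum_(_ < u (mxvec_index a b)) unit_degree a i0)%N] i)) /=.
rewrite (bigD1 i) //= [X in (_ + X)%N]big1 ?addn0 => [|k ki].
  apply: eq_bigr => j _; rewrite ffunE sum_nat_const card_ord !ffunE eqxx.
  by rewrite muln1.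
apply: big1 => j _; rewrite ffunE sum_nat_const !ffunE eq_sym (negPf ki).
by rewrite muln0.
Qed.

Lemma hom_component_act g d f :
  hom_component d (act g f) = act g (hom_component d f).
Proof.
rewrite {1}(mpolyE f) act_sum hom_component_sum.
rewrite [in RHS]/hom_component act_sum [RHS]big_mkcond; apply: eq_bigr => u _.
have hu : homogeneous (mon_degree u) (act g (f@_u *: 'X_[u])).
  by apply: homogeneous_act; apply: homogeneousZ; apply: homogeneousX.
by rewrite (hom_component_id _ hu).
Qed.

Lemma act_act g h f : act g (act h f) = act (fun i => g i *m h i) f.
Proof.
rewrite (mpolyE f) (act_sum h) !(act_sum g) act_sum; apply: eq_bigr => u _.
rewrite !actZ !act_monomial act_prod; congr (_ *: _); apply: eq_bigr => p _.
rewrite ![act g (_ ^+ _)]/act rmorphXn /= -!/(act _ _); congr (_ ^+ _).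
rewrite !act_xvar act_sum.
under eq_bigr => k _ do rewrite actZ act_xvar scaler_sumr.
rewrite exchange_big; apply: eq_bigr => k _ /=.
by rewrite mxE scaler_suml; apply: eq_bigr => l _; rewrite scalerA mulrC.
Qed.

Lemma act_id f : act (fun _ : 'I_m => 1%:M) f = f.
Proof.
rewrite [RHS](mpolyE f) {1}(mpolyE f) act_sum; apply: eq_bigr => u _.
rewrite actZ act_monomial; congr (_ *: _).
rewrite [RHS]mpolyXE_id (reindex _ (curry_mxvec_bij m n)) /=.
apply: eq_bigr => -[i j] _ /=; rewrite act_xvar (bigD1 j) //= mxE eqxx scale1r.
by rewrite big1 ?addr0 // => k kj; rewrite mxE (negPf kj) scale0r.
Qed.

Lemma actK (g : 'I_m -> 'M[K]_n) : in_G g ->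
  cancel (act (K := K) g) (act (fun i => invmx (g i))).
Proof.
move=> gG f; rewrite act_act -[RHS]act_id; congr (_ \mPo _).
by apply: eq_mktuple => q; congr (mxvec _ 0 q); apply/matrixP=> i j;
  rewrite !mxE; apply: eq_bigr => k _; rewrite mulVmx.
Qed.

Lemma actVK (g : 'I_m -> 'M[K]_n) : in_G g ->
  cancel (act (K := K) (fun i => invmx (g i))) (act g).
Proof.
move=> gG f; rewrite act_act -[RHS]act_id; congr (_ \mPo _).
by apply: eq_mktuple => q; congr (mxvec _ 0 q); apply/matrixP=> i j;
  rewrite !mxE; apply: eq_bigr => k _; rewrite mulmxV.
Qed.

Lemma act_ideal_is_ideal g I : in_G g -> is_ideal I -> is_ideal (act_ideal g I).
Proof.
move=> gG [I0 ID IM]; split.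
- by exists 0; rewrite ?act0.
- by move=> _ _ [f If ->] [h Ih ->]; exists (f + h); rewrite ?actD //; apply: ID.
- move=> c _ [f If ->]; exists (act (fun i => invmx (g i)) c * f).
    exact: IM.
  by rewrite actM actVK.
Qed.

Lemma multigraded_act g I : in_G g -> multigraded I -> multigraded (act_ideal g I).
Proof.
move=> gG [Iid Ih]; split; first exact: act_ideal_is_ideal.
move=> _ d [f If ->]; rewrite hom_component_act.
by exists (hom_component d f) => //; apply: Ih.
Qed.

End Homogeneous.

(** * Monomial ideals, normal forms and Hilbert functions *)

Section TermOrders.
Variables (m n : nat) (K : fieldType).
Local Notation S := {mpoly K[m * n]}.
Local Notation mon := 'X_{1.. m * n}.
Local Notation degree := {ffun 'I_m -> nat}.
Implicit Types (I J : S -> Prop) (f : S) (u w : mon) (d : degree).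

Lemma mxvec_index_inj (i i' : 'I_m) (j j' : 'I_n) :
  mxvec_index i j = mxvec_index i' j' -> i = i' /\ j = j'.
Proof. by move=> /cast_ord_inj /enum_rank_inj []. Qed.

Lemma mxvec_index_eq (i i' : 'I_m) (j j' : 'I_n) :
  (mxvec_index i j == mxvec_index i' j') = (i == i') && (j == j').
Proof.
by apply/eqP/andP=> [/mxvec_index_inj [-> ->]|[/eqP -> /eqP ->]]; rewrite ?eqxx.
Qed.

(** An ideal generated by monomials is recognised on supports.  The monomials in it
are described by a boolean test P, so that membership can be decided. *)
Lemma mem_monomial_ideal (E : S -> Prop) (P : pred mon) :
  (forall p, E p -> exists2 u, P u & p = 'X_[u]) ->
  (forall u w, P u -> P (u + w)%MM) ->
  (forall u, P u -> exists2 e, E 'X_[e] & (e <= u)%MM) ->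
  forall f, gen_ideal E f <-> {in msupp f, forall u, P u}.
Proof.
move=> EP Pup PE f; split=> [Ef u|Pf].
  pose I f := forall u, u \in msupp f -> P u.
  have Iid : is_ideal I.
    split=> [w|g h Ig Ih w /msuppD_le|c g Ig w /msuppM_le].
    - by rewrite msupp0.
    - by rewrite mem_cat => /orP[/Ig|/Ih].
    - by case/allpairsP=> [[a b] /= [_ /Ig Pb ->]]; rewrite addmC; apply: Pup.
  apply: (gen_ideal_min Iid _ Ef) => p /EP[w Pw ->] v.
  by rewrite msuppX inE => /eqP ->.
rewrite (mpolyE f) big_seq; apply: ideal_sum; first exact: gen_ideal_is_ideal.
move=> u /Pf /PE[e Ee eu]; rewrite -(submK eu) mpolyXD -mul_mpolyC mulrA.
have [_ _ EM] := gen_ideal_is_ideal E.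
exact/EM/mem_gen_ideal.
Qed.

Lemma mdeg_mon_degree u : mdeg u = (\sum_i mon_degree u i)%N.
Proof.
rewrite mdegE (reindex _ (curry_mxvec_bij m n)) /=.
under [RHS]eq_bigr => i _ do rewrite ffunE.
by rewrite pair_big /=; apply: eq_bigr => -[].
Qed.

Definition monomials_of_degree d : seq mon :=
  [seq u <- [seq bmnm b | b <- enum {: bmultinom (m * n) (\sum_i d i).+1}]
         | mon_degree u == d].

Lemma mem_monomials_of_degree d u :
  (u \in monomials_of_degree d) = (mon_degree u == d).
Proof.
rewrite mem_filter; case: eqP => //= ud.
have lt_u : (mdeg u < (\sum_i d i).+1)%N by rewrite mdeg_mon_degree ud.
by apply/mapP; exists (BMultinom lt_u); rewrite ?mem_enum.
Qed.

Section NormalForm.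
Variables (tau : rel mon) (J : S -> Prop) (P : pred mon).
Hypotheses (tau_to : term_order tau) (Jid : is_ideal J).
Hypothesis lead_P : forall u, P u ->
  exists p, [/\ J p, leading_mon tau p u & homogeneous (mon_degree u) p].

(** Division with respect to tau.  It terminates since only the finitely many
monomials of degree d occur: they are processed in decreasing order.  The last
clause keeps track of the leading monomial: if it fails P, no step alters its
coefficient. *)
Lemma normal_form d f : homogeneous d f ->
  exists r, [/\ homogeneous d r, J (f - r), {in msupp r, forall u, ~~ P u}
    & forall u, (forall w, w \in msupp f -> tau w u) -> ~~ P u -> r@_u = f@_u].
Proof.
have [[tau_refl tau_anti tau_trans tau_total] _ _ _] := tau_to.
pose gtau := [rel u w | tau w u].
pose l := sort gtau (monomials_of_degree d).
have l_d u : (u \in l) = (mon_degree u == d).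
  by rewrite mem_sort mem_monomials_of_degree.
have l_sorted : pairwise gtau l.
  rewrite -sorted_pairwise => [|u w v /= uw wv]; last exact: tau_trans wv uw.
  by apply: sort_sorted => u w; apply: tau_total.
have l_down u w : u \in l -> mon_degree w = d -> tau w u -> w \in l.
  by move=> _ wd _; rewrite l_d wd.
have l_deg u : u \in l -> mon_degree u = d by rewrite l_d => /eqP.
move=> hf; have fl u : u \in msupp f -> P u -> u \in l.
  by move=> /hf ud _; rewrite l_d ud.
elim: l l_sorted l_down l_deg f hf fl {l_d} => [_ _ _|u l IH /= /andP[ul ls] down deg] f hf fl.
  exists f; split=> //; first by rewrite subrr; case: Jid.
  by move=> u uf; apply/negP => /(fl _ uf).
have down' v w : v \in l -> mon_degree w = d -> tau w v -> w \in l.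
  move=> vl wd wv; have := down v w; rewrite !inE vl orbT => /(_ isT wd wv).
  case/predU1P=> // wu; have /allP/(_ v vl) /= vu := ul.
  by rewrite (tau_anti w v) // wv wu.
have deg' v : v \in l -> mon_degree v = d by move=> vl; apply: deg; rewrite inE vl orbT.
have {}IH := IH ls down' deg'.
have [/andP[uf Pu]|nPu] := boolP ((u \in msupp f) && P u); last first.
  apply: IH => // w wf Pw; have := fl w wf Pw; rewrite inE => /predU1P[wu|//].
  by move: nPu; rewrite -wu wf Pw.
have [p [Jp [up pu] hp]] := lead_P Pu.
pose c := f@_u / p@_u; have pu0 : p@_u != 0 by rewrite -mcoeff_msupp.
have hf' : homogeneous d (f - c *: p).
  by apply: homogeneousB => //; apply: homogeneousZ; rewrite -(hf _ uf).
have f'u : (f - c *: p)@_u = 0 by rewrite mcoeffB mcoeffZ divfK ?subrr.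
have [|r [hr Jr rP rf]] := IH _ hf'.
  move=> w wf' Pw; have wu : w != u.
    by apply: contraTneq wf' => ->; rewrite mcoeff_msupp f'u eqxx.
  suff : w \in u :: l by rewrite inE (negPf wu).
  move/msuppB_le: (wf'); rewrite mem_cat => /orP[wf|/msuppZ_le wp].
    exact: fl.
  by apply: (down u); rewrite ?mem_head ?(hf' _ wf') ?pu.
exists r; split=> // [|w fw nPw].
  have [_ JD JM] := Jid; rewrite (_ : f - r = c *: p + (f - c *: p - r)).
    by apply: JD => //; rewrite -mul_mpolyC; apply: JM.
  by rewrite addrA [c *: p + _]addrC subrK.
have uw : tau u w by apply: fw.
rewrite rf // => [|v /msuppB_le]; last first.
  rewrite mem_cat => /orP[/fw //|/msuppZ_le /pu vu].
  exact: tau_trans vu uw.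
rewrite mcoeffB mcoeffZ [p@_w]memN_msupp_eq0 ?mulr0 ?subr0 //.
apply/negP => /pu wu; have wE : w = u by apply: tau_anti; rewrite wu.
by move: nPw; rewrite wE Pu.
Qed.

End NormalForm.

(** The monomials failing P form a basis of S modulo J, in every degree. *)
Definition complements (P : pred mon) J :=
  (forall d f, homogeneous d f -> exists r,
     [/\ homogeneous d r, J (f - r) & {in msupp r, forall u, ~~ P u}]) /\
  (forall d f, homogeneous d f -> J f -> {in msupp f, forall u, ~~ P u} -> f = 0).

(** The normal forms of a basis modulo I are also a basis modulo J, because
both quotients are identified with the span of the same monomials. *)
Lemma hilbert_coef_complements P I J d r :
  is_ideal I -> is_ideal J -> complements P I -> complements P J ->
  hilbert_coef I d r -> hilbert_coef J d r.
Proof.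
move=> Iid Jid [nfI indI] [nfJ indJ] [b [hb bfree bspan]].
have [b' b'P] := fin_all_exists (fun a => nfI d _ (hb a)).
have hb' a : homogeneous d (b' a) by case: (b'P a).
have Ib' (c : 'I_r -> K) : I (\sum_a c a *: b a - \sum_a c a *: b' a).
  rewrite -sumrB; apply: ideal_sum => // a _; rewrite -scalerBr -mul_mpolyC.
  by case: Iid => _ _; apply; case: (b'P a).
have off (c : 'I_r -> K) : {in msupp (\sum_a c a *: b' a), forall u, ~~ P u}.
  move=> u /msupp_sum_le /flattenP[_ /mapP[a _ ->]] /msuppZ_le.
  by case: (b'P a) => _ _; apply.
have hom (c : 'I_r -> K) : homogeneous d (\sum_a c a *: b' a).
  by apply: homogeneous_sum => a _; apply: homogeneousZ.
exists b'; split=> // [c Jc|f hf].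
  apply: bfree; rewrite -[X in I X](subrK (\sum_a c a *: b' a)).
  rewrite [X in _ + X](indJ d _ _ Jc) ?addr0 //.
have [f' [hf' Jf' f'P]] := nfJ _ _ hf.
have [c Ic] := bspan _ hf'; exists c.
suff <- : f' = \sum_a c a *: b' a by [].
apply/eqP; rewrite -subr_eq0; apply/eqP; apply: (indI d).
- exact: homogeneousB.
- rewrite -(subrK (\sum_a c a *: b a) f') -addrA.
  by case: (Iid) => _ ID _; apply: ID => //; apply: Ib'.
- by move=> u /msuppB_le; rewrite mem_cat => /orP[/f'P|/off].
Qed.

Lemma hilbert_coef_act (g : 'I_m -> 'M[K]_n) I d r : in_G g ->
  hilbert_coef I d r <-> hilbert_coef (act_ideal g I) d r.
Proof.
move=> gG; pose g' i : 'M[K]_n := invmx (g i).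
split=> -[b [hb bfree bspan]].
  exists (fun a => act g (b a)); split=> [a|c|f hf].
  - exact: homogeneous_act.
  - under eq_bigr => a _ do rewrite -actZ.
    by rewrite -act_sum => -[f If] /(can_inj (actK gG)) cf; apply: bfree; rewrite cf.
  - have [c Ic] := bspan _ (homogeneous_act (g := g') hf); exists c.
    under eq_bigr => a _ do rewrite -actZ.
    by rewrite -act_sum -{1}(actVK gG f) -actB; exists (act g' f - \sum_a c a *: b a).
exists (fun a => act g' (b a)); split=> [a|c|f hf].
- exact: homogeneous_act.
- under eq_bigr => a _ do rewrite -actZ.
  rewrite -act_sum => Ic; apply: bfree; exists (act g' (\sum_a c a *: b a)) => //.
  by rewrite actVK.
- have [c [h Ih hE]] := bspan _ (homogeneous_act (g := g) hf); exists c.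
  under eq_bigr => a _ do rewrite -actZ.
  by rewrite -act_sum -(actK gG f) -actB hE actK.
Qed.

Lemma same_hilbert_series_complements P (g : 'I_m -> 'M[K]_n) I J :
  in_G g -> is_ideal I -> is_ideal J ->
  complements P (act_ideal g I) -> complements P J -> same_hilbert_series I J.
Proof.
move=> gG Iid Jid cI cJ d r; rewrite (hilbert_coef_act I d r gG).
have gIid := act_ideal_is_ideal gG Iid.
by split; apply: hilbert_coef_complements cJ || apply: hilbert_coef_complements cI.
Qed.

Lemma leading_monomial_mul tau (p : S) e u : term_order tau ->
  leading_mon tau p e -> homogeneous (mon_degree e) p -> (e <= u)%MM ->
  leading_mon tau (p * 'X_[u - e]) u /\ homogeneous (mon_degree u) (p * 'X_[u - e]).
Proof.
move=> [_ _ tauD _] [lead1 lead2] hp le_u; split; first split.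
- by rewrite mcoeff_msupp -[X in _@_X](submK le_u) mcoeffMX -mcoeff_msupp.
- move=> v /msuppM_le /allpairsP[[a c] /= [/lead2 ab]]; rewrite msuppX inE => /eqP -> ->.
  by rewrite -[X in tau _ X](submK le_u) [X in tau _ X]addmC; apply: tauD.
- have := homogeneousM hp (@homogeneousX _ _ K (u - e)%MM).
  by rewrite -mon_degreeD addmC submK.
Qed.

Lemma leading_hom_component tau f u :
  leading_mon tau f u -> leading_mon tau (hom_component (mon_degree u) f) u.
Proof.
case=> uf fu; split=> [|w]; rewrite msupp_hom_component ?eqxx //.
by case/andP=> _ /fu.
Qed.

(** Positions in the enumeration of a product, used to see that the variables of a
row are numbered in increasing order. *)
Lemma index_allpairs (T1 T2 : eqType) (s : seq T1) (t : seq T2) x y :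
  x \in s -> y \in t ->
  index (x, y) [seq (a, b) | a <- s, b <- t] = (index x s * size t + index y t)%N.
Proof.
move=> xs yt; elim: s xs => //= a s IH; rewrite inE eq_sym.
case: eqVneq => [->|ax] /= xs.
  rewrite index_cat map_f // index_map // => b c []//.
rewrite index_cat size_map IH // ifN ?mulSn ?addnA //.
by apply/mapP => -[b _ [xa]]; rewrite xa eqxx in ax.
Qed.

Lemma ltn_mxvec_index (i : 'I_m) (j k : 'I_n) :
  (j < k)%N -> (mxvec_index i j < mxvec_index i k)%N.
Proof.
have E (l : 'I_n) : mxvec_index i l =
    (index i (enum 'I_m) * size (enum 'I_n) + index l (enum 'I_n))%N :> nat.
  rewrite /mxvec_index /= /enum_rank enum_rank_in.unlock insubdK; last first.
    by rewrite -topredE /= cardE index_mem mem_enum.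
  by rewrite -index_allpairs ?mem_enum // enumT unlock.
by rewrite !E !index_enum_ord ltn_add2l.
Qed.

(** The Hilbert series is computed with one particular term order, which has to
exist. *)
Lemma monomial_order_is_term_order :
  term_order (fun u w : mon => (u <= w)%O).
Proof.
split=> [|u|u v w uv|i j k jk].
- by split; [exact: lexx | exact: le_anti | exact: le_trans | exact: le_total].
- exact: le0x.
- by rewrite lemc_add2l.
- apply/ltW/ltmcP; rewrite ?mdeg1 //; exists (mxvec_index i j).
    move=> q; case/mxvec_indexP: q => i' j' lt_q; rewrite !mnm1E !mxvec_index_eq.
    have [ii|//] := eqVneq i i'; rewrite -ii in lt_q *.
    have lt_q2 := ltn_trans lt_q (ltn_mxvec_index i jk).
    by case: eqVneq lt_q2 => [<-|_]; rewrite ?ltnn //; case: eqVneq lt_q => [<-|];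
       rewrite ?ltnn.
  rewrite !mnm1E !mxvec_index_eq !eqxx /=; case: eqVneq jk => [->|] //.
  by rewrite ltnn.
Qed.

Definition avoids (v : degree) u :=
  [forall i, forall j : 'I_n, (j < v i)%N ==> (u (mxvec_index i j) == 0%N)].

Lemma P_idealP (v : degree) f :
  @P_ideal m n K v f <-> {in msupp f, forall u, ~~ avoids v u}.
Proof.
have hit u i (j : 'I_n) : (j < v i)%N -> u (mxvec_index i j) != 0%N -> ~~ avoids v u.
  move=> jv uij; apply/negP => /forallP/(_ i)/forallP/(_ j); rewrite jv /=.
  by rewrite (negPf uij).
apply: mem_monomial_ideal => [p [i [j [jv ->]]]|u w|u].
- exists U_(mxvec_index i j)%MM => //; apply: (hit _ i j) => //.
  by rewrite mnm1E eqxx.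
- case/forallPn=> i /forallPn[j]; rewrite negb_imply => /andP[jv uij].
  by apply: (hit _ i j) => //; rewrite mnmDE addn_eq0 negb_and uij.
- case/forallPn=> i /forallPn[j]; rewrite negb_imply => /andP[jv uij].
  by exists U_(mxvec_index i j)%MM; [exists i, j | rewrite lep1mP].
Qed.

Lemma P_ideal_prime (v : degree) : prime_ideal (@P_ideal m n K v).
Proof.
(* P_v is the kernel of this substitution, whose target is a domain. *)
pose kill := [tuple (if avoids v U_(q)%MM then 'X_q else 0 : S) | q < m * n].
have killX u : 'X_[u] \mPo kill = if avoids v u then 'X_[u] else 0.
  rewrite comp_mpolyX; case: ifP => av.
    rewrite [RHS]mpolyXE_id; apply: eq_bigr => q _; rewrite tnth_mktuple.
    have [->|uq] := eqVneq (u q) 0%N; first by rewrite !expr0.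
    rewrite ifT //; apply/forallP => i; apply/forallP => j; apply/implyP => jv.
    move/forallP/(_ i)/forallP/(_ j): av; rewrite jv /= mnm1E => /eqP uij.
    by rewrite eqb0; apply: contraNneq uq => ->; rewrite uij.
  move/negbT: av; case/forallPn=> i /forallPn[j]; rewrite negb_imply => /andP[jv uij].
  rewrite (bigD1 (mxvec_index i j)) //= tnth_mktuple ifN ?expr0n ?(negPf uij) ?mul0r //.
  by apply/negP => /forallP/(_ i)/forallP/(_ j); rewrite jv mnm1E eqxx.
have killE f u : (f \mPo kill)@_u = if avoids v u then f@_u else 0.
  rewrite -mcoeff_restrict {1}(mpolyE f) (raddf_sum (comp_mpoly kill)) /=.
  rewrite [in RHS]big_mkcond; congr mcoeff; apply: eq_bigr => w _.
  by rewrite comp_mpolyZ killX; case: ifP => // _; rewrite scaler0.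
have kerP f : @P_ideal m n K v f <-> f \mPo kill = 0.
  rewrite P_idealP; split=> [fP|f0 u uf].
    apply/mpolyP => u; rewrite killE mcoeff0; case: ifP => // av.
    by apply: memN_msupp_eq0; apply/negP => /fP; rewrite av.
  apply/negP => av; have := killE f u; rewrite f0 av mcoeff0 => /esym/eqP.
  by rewrite mcoeff_eq0 uf.
split; first exact: gen_ideal_is_ideal.
  by rewrite kerP comp_mpoly1 => /eqP; rewrite oner_eq0.
move=> f h; rewrite !kerP rmorphM => /eqP; rewrite mulf_eq0.
by case/orP=> /eqP; [left|right].
Qed.

Lemma prime_ideal_radical I f k : prime_ideal I -> I (f ^+ k) -> I f.
Proof.
case=> _ I1 IM; elim: k => [|k IH]; first by rewrite expr0.
by rewrite exprS => /IM[].
Qed.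

End TermOrders.

(** * Generators and facets *)

Section Combinatorics.
Local Open Scope nat_scope.
Variables (m n : nat).
Local Notation mon := 'X_{1.. m * n}.
Local Notation degree := {ffun 'I_m -> nat}.
Implicit Types (u : mon) (A B : {set 'I_m}) (v : degree).

(** The index, counted from 0, of the largest variable of row i dividing u; it is
n if there is none. *)
Definition first_var u (i : 'I_m) : nat :=
  find (fun j => u (mxvec_index i j) != 0) (enum 'I_n).

(** The bound k may exceed n, whence the minimum. *)
Lemma first_var_leP u i (k : nat) :
  reflect (forall j : 'I_n, j < k -> u (mxvec_index i j) = 0) (minn k n <= first_var u i).
Proof.
apply: (iffP idP) => [le_k j jk|u0].
  have lt_j : j < first_var u i by apply: leq_trans le_k; rewrite leq_min jk /=.
  by have := before_find j lt_j; rewrite nth_ord_enum => /negbFE/eqP.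
rewrite leqNgt; apply/negP; rewrite leq_min => /andP[lt_k lt_n].
have := nth_find (Ordinal lt_n) (a := fun j => u (mxvec_index i j) != 0) (s := enum 'I_n).
rewrite has_find size_enum_ord -/(first_var u i) lt_n => /(_ isT).
by rewrite u0 ?eqxx // nth_enum_ord.
Qed.

Lemma first_var_neq0 u i (j : 'I_n) :
  j = first_var u i :> nat -> u (mxvec_index i j) != 0.
Proof.
move=> jE; have lt_n : first_var u i < n by rewrite -jE.
have := nth_find j (a := fun j => u (mxvec_index i j) != 0) (s := enum 'I_n).
rewrite has_find size_enum_ord -/(first_var u i) lt_n => /(_ isT).
by rewrite -[X in nth _ _ X]jE nth_ord_enum.
Qed.

Lemma first_var_ub u i (j : 'I_n) : u (mxvec_index i j) != 0 -> first_var u i <= j.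
Proof.
move=> uij; rewrite leqNgt; apply: contra uij => lt_j.
by have := before_find j lt_j; rewrite nth_ord_enum => /negbFE.
Qed.

(* Only the monotonicity of w_A = n - dim V_A matters in this section. *)
Variable w : {set 'I_m} -> nat.
Let d i := w [set i].
Hypothesis w_anti : forall A B, A \subset B -> w B <= w A.

Lemma w_le_d A i : i \in A -> w A <= d i.
Proof. by move=> iA; apply: w_anti; rewrite sub1set. Qed.

Definition active u := [set i | first_var u i < d i].

(** Since w decreases when A grows, a monomial is divisible by a generator if and
only if it is divisible by the one built from its active rows and its first
variables.  This makes membership in the monomial ideal decidable. *)
Definition in_gin u := w (active u) <= \sum_(i in active u) (d i - (first_var u i).+1).

Definition gin_mon A (b : 'I_m -> 'I_n) : mon :=
  (\sum_(i in A) U_(mxvec_index i (b i)))%MM.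

(** The condition of (2), written with natural numbers and with b counted
from 0. *)
Definition gin_cond A (b : 'I_m -> 'I_n) :=
  (forall i, i \in A -> b i < d i) /\ w A <= \sum_(i in A) (d i - (b i).+1).

Lemma gin_monE A b i j :
  gin_mon A b (mxvec_index i j) = (i \in A) && (b i == j) :> nat.
Proof.
rewrite /gin_mon mnm_sumE; have [iA|iA] := boolP (i \in A).
  rewrite (bigD1 i) //= mnm1E mxvec_index_eq eqxx big1 ?addn0 // => k /andP[_ ki].
  by rewrite mnm1E mxvec_index_eq (negPf ki).
rewrite big1 // => k kA; rewrite mnm1E mxvec_index_eq.
by case: eqP => // ki; rewrite -ki kA in iA.
Qed.

Lemma sum_subset A B (F : 'I_m -> nat) :
  A \subset B -> \sum_(i in A) F i <= \sum_(i in B) F i.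
Proof.
move=> AB; rewrite [leqRHS](big_setID A) /= (setIidPr AB); exact: leq_addr.
Qed.

Lemma gin_cond_in_gin A b u : gin_cond A b -> (gin_mon A b <= u)%MM -> in_gin u.
Proof.
case=> bd wA /mnm_lepP Abu.
have ub i : i \in A -> first_var u i <= b i.
  move=> iA; apply: first_var_ub; have := Abu (mxvec_index i (b i)).
  by rewrite gin_monE iA eqxx lt0n.
have AR : A \subset active u.
  by apply/subsetP => i iA; rewrite inE; apply: leq_ltn_trans (ub i iA) (bd i iA).
apply: leq_trans (w_anti AR) (leq_trans wA _); apply: leq_trans (sum_subset _ AR).
by apply: leq_sum => i iA; rewrite leq_sub2l // ltnS ub.
Qed.

Definition short v := [set i | v i < d i].

(** The conditions of (3) in terms of s_i = d_i - v_i - 1, which is nonnegative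
exactly on [short v]. *)
Definition facet v :=
  [/\ forall i, v i <= d i,
      (\sum_(i in short v) (d i - (v i).+1)).+1 = w (short v)
    & forall B, short v \proper B -> w B < w (short v)].

(** If v <= v' then s >= s' and the short set of v contains that of v'.  A strict
inclusion would force w to drop while the sum of s does not decrease. *)
Lemma facet_antichain v v' : facet v -> facet v' -> (forall i, v i <= v' i) -> v = v'.
Proof.
move=> [vd vE vmax] [v'd v'E v'max] vv'.
have sub : short v' \subset short v.
  by apply/subsetP => i; rewrite !inE; apply: leq_ltn_trans.
have le_sum : \sum_(i in short v') (d i - (v' i).+1) <= \sum_(i in short v) (d i - (v i).+1).
  apply: leq_trans (sum_subset _ sub); apply: leq_sum => i _.
  by rewrite leq_sub2l // ltnS.
have [lt|] := boolP (short v' \proper short v).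
  by have := v'max _ lt; rewrite -vE -v'E ltnS ltnNge le_sum.
rewrite properE sub /= negbK => sub'.
have sE : short v = short v' by apply/eqP; rewrite eqEsubset sub sub'.
have eq_sum : \sum_(i in short v) (d i - (v i).+1) = \sum_(i in short v) (d i - (v' i).+1).
  by apply: succn_inj; rewrite vE sE.
apply/ffunP => i; have [iA|] := boolP (i \in short v); last first.
  move=> iA; apply/eqP; rewrite eqn_leq vv' /=; move: iA; rewrite inE -leqNgt.
  by apply: leq_trans.
have iA' : i \in short v' by rewrite -sE.
have le_rest : \sum_(k in short v | k != i) (d k - (v' k).+1) <=
   \sum_(k in short v | k != i) (d k - (v k).+1).
  by apply: leq_sum => k _; rewrite leq_sub2l // ltnS.
have split_sum F : \sum_(k in short v) F k = F i + \sum_(k in short v | k != i) F k.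
  by rewrite (bigD1 i).
move: eq_sum le_rest (vv' i) iA iA'; rewrite !split_sum !inE /=.
by set x := \sum_(k in _ | _) _; set y := \sum_(k in _ | _) _; lia.
Qed.

Hypothesis w0 : w set0 = n.

Lemma d_le_n i : d i <= n. Proof. by rewrite -w0; apply/w_anti/sub0set. Qed.

(** If u avoids the variables of P_v, then its active rows are short and its
exponent vector d_i - mu_i is at most s_i, so its sum is less than w. *)
Lemma facet_in_gin v u : facet v -> in_gin u -> ~~ avoids v u.
Proof.
case=> vd vE _ uM; apply/negP => /forallP av.
have v_le i : v i <= first_var u i.
  have /minn_idPl <- : v i <= n by apply: leq_trans (vd i) (d_le_n i).
  apply/first_var_leP => j jv; apply/eqP.
  by have /forallP/(_ j) := av i; rewrite jv.
have RA : active u \subset short v.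
  by apply/subsetP => i; rewrite !inE; apply: leq_ltn_trans.
move: uM; rewrite /in_gin leqNgt => /negP; apply.
apply: leq_trans (w_anti RA); rewrite -vE ltnS.
apply: leq_trans (sum_subset _ RA).
by apply: leq_sum => i iR; rewrite leq_sub2l // ltnS.
Qed.

(** Enlarge the active set of u to a maximal A with the same w, keep the vector
d_i - mu_i on the active rows, put 0 on the others, and add to one entry
whatever is missing to reach w_A - 1.  No entry becomes too large since
w_A <= d_i on A. *)
Lemma facet_cover u : ~~ in_gin u -> (exists i, 0 < d i) \/ n = 1 ->
  exists v, facet v /\ avoids v u.
Proof.
move=> uM dn; pose a i := d i - (first_var u i).+1.
have [/existsP[i0 di0]|/existsPn d0] := boolP [exists i, 0 < d i]; last first.
  case: dn => [[i di]|n1]; first by have := d0 i; rewrite di.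
  exists [ffun=> 0]; split; last first.
    by apply/forallP => i; apply/forallP => j; rewrite ffunE.
  have s0 : short [ffun=> 0] = set0.
    by apply/setP => i; rewrite !inE ffunE (negPf (d0 i)).
  split=> [i||B]; rewrite ?ffunE // s0 ?big_set0 ?w0 ?n1 // proper0 => /set0Pn[i iB].
  by apply: leq_ltn_trans (w_le_d iB) _; have := d0 i; rewrite -leqNgt leqn0 => /eqP ->.
(* Without active rows the enlargement starts from a nonzero row. *)
pose A0 := if active u == set0 then [set i0] else active u.
have a0 i : i \notin active u -> a i = 0 by rewrite inE /a; lia.
have A0n0 : exists i1, i1 \in A0.
  rewrite /A0; case: eqVneq => [_|/set0Pn//]; by exists i0; rewrite inE.
have RA0 : active u \subset A0.
  by rewrite /A0; case: eqP => // ->; rewrite sub0set.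
have aA0 : \sum_(i in A0) a i < w A0.
  rewrite /A0; case: eqVneq => [R0|_]; last by rewrite ltnNge.
  by rewrite big_set1 a0 // R0 inE.
pose closed B := (A0 \subset B) && (w B == w A0).
have [|A /maxsetP[/andP[A0A /eqP wA] maxA] _] := @maxset_exists _ closed A0.
  by rewrite /closed subxx eqxx.
have sumA : \sum_(i in A) a i = \sum_(i in A0) a i.
  rewrite (big_setID A0) /= (setIidPr A0A) [X in _ + X]big1 ?addn0 // => i.
  rewrite inE => /andP[iA0 _]; apply: a0; apply: contra iA0; exact/subsetP.
have [i1 i1A0] := A0n0; have i1A : i1 \in A by apply: (subsetP A0A).
pose e := w A - (\sum_(i in A) a i).+1.
have eE : (\sum_(i in A) a i) + e + 1 = w A by rewrite /e; move: aA0; rewrite -wA -sumA; lia.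
pose c i := a i + (if i == i1 then e else 0).
have sumc : \sum_(i in A) c i + 1 = w A.
  rewrite big_split /= -big_mkcondr /= -eE; congr (_ + _ + _).
  rewrite (eq_bigl (pred1 i1)) ?big_pred1_eq // => i /=.
  by case: eqP => [->|]; rewrite ?i1A ?andbF.
have c_lt i : i \in A -> c i < d i.
  move=> iA; apply: leq_trans (w_le_d iA); rewrite -sumc addn1 ltnS.
  by rewrite (bigD1 i) //= leq_addr.
pose v : degree := [ffun i => if i \in A then d i - (c i).+1 else d i].
have sv : short v = A.
  apply/setP => i; rewrite !inE ffunE; case: ifP => iA; last by rewrite ltnn.
  by have := c_lt i iA; lia.
exists v; split; first split=> [i||B].
- by rewrite ffunE; case: ifP; lia.
- rewrite sv -sumc addn1; congr (_.+1); apply: eq_bigr => i iA.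
  by rewrite ffunE iA; have := c_lt i iA; lia.
- rewrite sv => AB; rewrite ltn_neqAle (w_anti (proper_sub AB)) andbT.
  apply/negP => /eqP wB; have := maxA B; rewrite /closed wB wA eqxx andbT.
  rewrite (subset_trans A0A (proper_sub AB)) => /(_ isT (proper_sub AB)) BA.
  by rewrite BA properxx in AB.
apply/forallP => i; apply/forallP => j; apply/implyP => jv; apply/eqP.
have : minn (v i) n <= first_var u i; last by move/first_var_leP; apply.
apply: leq_trans (geq_minl _ _) _; rewrite ffunE; case: ifP => [iA|/negbT iA].
  by have := c_lt i iA; rewrite /c /a; lia.
have : i \notin active u by apply: contra iA => iR; apply/(subsetP A0A)/(subsetP RA0).
by rewrite inE -leqNgt.
Qed.

Hypothesis n_gt0 : 0 < n.

Lemma in_gin_cond u : in_gin u ->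
  exists A b, gin_cond A b /\ (gin_mon A b <= u)%MM.
Proof.
move=> uM; pose b i : 'I_n := insubd (Ordinal n_gt0) (first_var u i).
have bE i : i \in active u -> b i = first_var u i :> nat.
  rewrite inE => lt_d; rewrite /b /insubd insubT //=.
  by apply: leq_trans lt_d (d_le_n i).
exists (active u), b; split; first split=> [i iR|].
- by rewrite bE //; move: iR; rewrite inE.
- by apply: leq_trans uM _; apply: leq_sum => i iR; rewrite bE.
- apply/mnm_lepP => q; case/mxvec_indexP: q => i j; rewrite gin_monE.
  case: andP => //= -[iR /eqP <-]; rewrite lt0n; apply: first_var_neq0; exact: bE.
Qed.

Lemma in_gin_up u u' : in_gin u -> in_gin (u + u')%MM.
Proof.
move=> /in_gin_cond[A [b [Ab bu]]]; apply: gin_cond_in_gin Ab _.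
exact: lepm_trans bu (lem_addr _ _).
Qed.

End Combinatorics.

(** * Orthogonal spaces, flags and the components of the locus *)

Section Duality.
Variables (K : fieldType) (n : nat).
Implicit Types (U W : {vspace 'rV[K]_n}) (x z : 'rV[K]_n).

(** A vector killed by the annihilator of a row space belongs to that row space. *)
Lemma row_space_dual p (M : 'M[K]_(p, n)) x :
  (forall y : 'rV[K]_n, y *m M^T = 0 -> x *m y^T = 0) -> exists c, x = c *m M.
Proof.
move=> xM; suff : (x <= M)%MS by case/submxP=> c ->; exists c.
rewrite submxE; move: (mulmx_coker M); move: (cokermx M) => D MD.
apply/eqP/rowP => j; rewrite [in RHS]mxE.
have := xM (col j D)^T; rewrite trmxK -trmx_mul colE !mulmxA MD.
rewrite mul0mx trmx0 -colE => /(_ erefl).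
by move=> /(congr1 (fun M : 'M_1 => M 0 0)); rewrite !mxE.
Qed.

Definition basis_mx U : 'M[K]_(\dim U, n) := \matrix_(i < \dim U) (vbasis U)`_i.

Lemma mem_basis_mxP U x : reflect (exists c, x = c *m basis_mx U) (x \in U).
Proof.
have E c : c *m basis_mx U = \sum_i c 0 i *: (vbasis U)`_i.
  by rewrite mulmx_sum_row; apply: eq_bigr => i _; rewrite rowK.
apply: (iffP idP) => [xU|[c ->]].
  exists (\row_i vector.coord (vbasis U) i x); rewrite E {1}(coord_vbasis xU).
  by apply: eq_bigr => i _; rewrite mxE.
rewrite E memv_suml // => i _; rewrite memvZ // vbasis_mem // mem_nth //.
by rewrite size_tuple.
Qed.

Lemma basis_mx_free U : row_free (basis_mx U).
Proof.
apply: inj_row_free => v; rewrite mulmx_sum_row => v0.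
apply/rowP => i; rewrite mxE.
have /freeP/(_ (fun i => v 0 i)) := basis_free (vbasisP U); apply.
by rewrite -[RHS]v0; apply: eq_bigr => k _; rewrite rowK.
Qed.

(** The orthogonal space for the standard bilinear form; it identifies the column
space of a matrix with the orthogonal of its left kernel. *)
Definition ortho U : {vspace 'rV[K]_n} :=
  lker (linfun (mulmxr (basis_mx U)^T : 'rV_n -> 'rV_(\dim U))).

Lemma orthoP U x : reflect (forall y, y \in U -> y *m x^T = 0) (x \in ortho U).
Proof.
rewrite memv_ker lfunE /=; apply: (iffP eqP) => [xU y /mem_basis_mxP[c ->]|xU].
  by rewrite -mulmxA -[X in X *m x^T]trmxK -trmx_mul xU trmx0 mulmx0.
apply/eqP; rewrite -trmx_eq0 trmx_mul trmxK; apply/eqP/row_matrixP => i.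
rewrite row_mul xU ?row0 //; apply/mem_basis_mxP; exists (delta_mx 0 i).
by rewrite rowE.
Qed.

Lemma ortho_dim_le U W : (forall x y, x \in U -> y \in W -> x *m y^T = 0) ->
  (\dim U + \dim W <= n)%N.
Proof.
move=> UW; have := mulmx0_rank_max (A := basis_mx U) (B := (basis_mx W)^T).
rewrite mxrank_tr (eqP (basis_mx_free U)) (eqP (basis_mx_free W)); apply.
apply/matrixP => i j.
have rowU V (k : 'I_(\dim V)) : row k (basis_mx V) \in V.
  by apply/mem_basis_mxP; exists (delta_mx 0 k); rewrite rowE.
have := UW _ _ (rowU U i) (rowU W j).
move=> /(congr1 (fun M : 'M_1 => M 0 0)); rewrite !mxE => E.
by rewrite -[RHS]E; apply: eq_bigr => k _; rewrite !mxE.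
Qed.

Lemma dim_ortho U : \dim (ortho U) = (n - \dim U)%N.
Proof.
apply/eqP; rewrite eqn_leq; apply/andP; split.
  suff : (\dim U + \dim (ortho U) <= n)%N by lia.
  by apply: ortho_dim_le => x y xU /orthoP; apply.
pose f := linfun (mulmxr (basis_mx U)^T : 'rV_n -> 'rV_(\dim U)).
have := limg_ker_dim f fullv; rewrite capfv dimvf /dim /= mul1n -/(ortho U).
have := dimvS (subvf (limg f)).
rewrite [X in (_ <= X)%N]dimvf /dim /= mul1n => img_le eq_n.
by rewrite leq_subLR -[leqLHS]eq_n addnC leq_add.
Qed.

Lemma fullv_ortho U : (forall z, z \in ortho U -> z = 0) -> U = fullv.
Proof.
move=> U0; apply/eqP; rewrite eqEdim subvf dimvf /dim /= mul1n.
have : ortho U = 0%VS by apply/eqP; rewrite -subv0; apply/subvP => z /U0 ->; rewrite mem0v.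
by move/(congr1 (fun W => \dim W)); rewrite dimv0 dim_ortho; lia.
Qed.

End Duality.

Lemma linear_dependency (K : fieldType) (vT : vectType K) (I : finType)
    (t : I -> vT) (T : {vspace vT}) :
  (forall a, t a \in T) -> (\dim T < #|I|)%N ->
  exists x : I -> K, (exists a, x a != 0) /\ \sum_a x a *: t a = 0.
Proof.
move=> tT lt_I; pose A := \matrix_(a < #|I|, j < \dim T) vector.coord (vbasis T) j (t (enum_val a)).
have /rowV0Pn[v /sub_kermxP vA v0] : kermx A != 0.
  by rewrite kermx_eq0 /row_free neq_ltn (leq_ltn_trans (rank_leq_col A)).
exists (fun a => v 0 (enum_rank a)); split.
  have /rV0Pn[a va] := v0.
  by exists (enum_val a); rewrite enum_valK.
rewrite (reindex _ (onW_bij _ (enum_val_bij I))) /=.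
under eq_bigr => a _ do rewrite (coord_vbasis (tT (enum_val a))) enum_valK scaler_sumr.
rewrite exchange_big /= big1 // => j _.
under eq_bigr => a _ do rewrite scalerA.
rewrite -scaler_suml; have := congr1 (fun M : 'rV_ _ => M 0 j) vA; rewrite !mxE.
by under eq_bigr => a _ do rewrite mxE; move=> ->; rewrite scale0r.
Qed.

Section GeneralPosition.
Variables (m n : nat) (K : fieldType).
Variables (V : 'I_m -> {vspace 'rV[K]_n}) (B : 'I_m -> 'M[K]_n).
Implicit Types (A : {set 'I_m}) (b : 'I_m -> nat).

(** The number w_A, and d_i for a singleton. *)
Definition codim_sum A : nat := n - \dim (\sum_(i in A) V i)%VS.
Local Notation w := codim_sum.
Local Notation d i := (w [set i]).

Lemma codim_sum1 i : d i = (n - \dim (V i))%N.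
Proof. by rewrite /w big_set1. Qed.

Lemma codim_sum0 : w set0 = n.
Proof. by rewrite /w big_set0 dimv0 subn0. Qed.

Lemma codim_sum_anti A A' : A \subset A' -> (w A' <= w A)%N.
Proof.
move=> AA'; rewrite leq_sub2l // dimvS //; apply/subv_sumP => i iA.
by apply: (sumv_sup i); rewrite ?subvv // (subsetP AA').
Qed.

Lemma mul_pid_mxE (x : 'rV[K]_n) (b : nat) (h : 'I_n) :
  (x *m pid_mx b) 0 h = if (h < b)%N then x 0 h else 0.
Proof.
rewrite mxE (bigD1 h) //= big1 ?addr0 => [|k kh]; rewrite mxE ?eqxx /=.
  by case: ifP; rewrite ?mulr1 ?mulr0.
by rewrite (_ : (k == h :> nat) = false) ?mulr0 //; apply/negbTE.
Qed.

(** With B i the coefficient matrix of row i, the combinations of the entries of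
this row which do not involve its first b variables. *)
Definition flag i (b : nat) : {vspace 'rV[K]_n} :=
  lker (linfun (mulmxr (B i *m (pid_mx b : 'M_n)))).

Lemma flagP i (b : nat) v :
  reflect (forall h : 'I_n, (h < b)%N -> (v *m B i) 0 h = 0) (v \in flag i b).
Proof.
rewrite memv_ker lfunE /= mulmxA; apply: (iffP eqP) => [v0 h hb|v0].
  by have := mul_pid_mxE (v *m B i) b h; rewrite hb v0 mxE.
by apply/rowP => h; rewrite mul_pid_mxE [in RHS]mxE; case: ifP => // hb; apply: v0.
Qed.

(** The two conditions of general position.  The first one says that the first d_i
columns of B i are linearly independent, the second one that the flags are
transverse whenever their dimensions allow it. *)
Definition independent_columns := forall i (x : 'rV[K]_n),
  (forall h : 'I_n, (d i <= h)%N -> x 0 h = 0) -> x *m (B i)^T = 0 -> x = 0.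

Definition spanning_flags := forall A b, A != set0 ->
  (forall i, i \in A -> b i <= d i)%N -> (w A <= \sum_(i in A) (d i - b i))%N ->
  (\sum_(i in A) flag i (b i))%VS = fullv.

Hypothesis VB : forall i v, v \in V i -> v *m B i = 0.
Hypothesis indep : independent_columns.
Hypothesis spans : spanning_flags.

(** The dual form of transversality: the spaces spanned by the first b_i columns
of B i have no common vector. *)
Lemma flag_ortho_eq0 A b (z : 'rV[K]_n) (x : 'I_m -> 'rV[K]_n) : A != set0 ->
  (forall i, i \in A -> b i <= d i)%N -> (w A <= \sum_(i in A) (d i - b i))%N ->
  (forall i, i \in A -> z = x i *m (B i)^T) ->
  (forall i (h : 'I_n), i \in A -> (b i <= h)%N -> x i 0 h = 0) -> z = 0.
Proof.
move=> A0 bd wA zE x0.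
suff v0 (v : 'rV[K]_n) : v *m z^T = 0.
  apply/rowP => j; have := v0 (delta_mx 0 j); rewrite -rowE.
  by move=> /(congr1 (fun M : 'M_1 => M 0 0)); rewrite !mxE.
have : v \in (\sum_(i in A) flag i (b i))%VS by rewrite spans // memvf.
case/memv_sumP => vs vsF ->; rewrite mulmx_suml big1 // => i iA.
rewrite (zE _ iA) trmx_mul trmxK mulmxA; apply/rowP => o; rewrite ord1 !mxE.
apply: big1 => h _; have [hb|bh] := ltnP h (b i).
  by have /flagP/(_ h hb) -> := vsF _ iA; rewrite mul0r.
by rewrite [(x i)^T _ _]mxE x0 // mulr0.
Qed.

Lemma codim_sum1_le i : (d i <= n)%N. Proof. exact: leq_subr. Qed.

Lemma V_sub_flag i (b : nat) : (V i <= flag i b)%VS.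
Proof. by apply/subvP => v /VB vB; apply/flagP => h _; rewrite vB mxE. Qed.

(** Combinations without the first d_i variables vanish, since the first d_i columns
span the column space; only the relations remain. *)
Lemma flag_max i : flag i (d i) = V i.
Proof.
apply/esym/eqP; rewrite eqEdim V_sub_flag /=.
pose X := [tuple row (widen_ord (codim_sum1_le i) h) (B i)^T | h < d i].
have XE (h : 'I_(d i)) : X`_h = row (widen_ord (codim_sum1_le i) h) (B i)^T.
  by rewrite -tnth_nth tnth_mktuple.
have freeX : free X.
  apply/freeP => c c0 h.
  pose x : 'rV[K]_n := \row_k (if insub (val k) is Some h' then c h' else 0).
  have xE (h' : 'I_(d i)) : x 0 (widen_ord (codim_sum1_le i) h') = c h'.
    by rewrite mxE /= valK.
  rewrite -xE (indep (i := i) (x := x)) ?mxE // => [k dk|].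
    by rewrite mxE insubF // ltnNge dk.
  rewrite mulmx_sum_row -[RHS]c0 (bigID (fun k : 'I_n => k < d i)%N) /=.
  rewrite [X in _ + X]big1 ?addr0 => [|k dk]; last first.
    by rewrite mxE insubF ?scale0r //; apply/negbTE.
  rewrite (big_ord_narrow (codim_sum1_le i)).
  by apply: eq_bigr => k _; rewrite xE -XE.
have : (<<X>> <= ortho (flag i (d i)))%VS.
  apply/span_subvP => _ /tnthP[h ->]; rewrite tnth_mktuple; apply/orthoP => y /flagP yF.
  rewrite tr_row trmxK colE mulmxA -colE; apply/rowP => o.
  by rewrite !ord1 [LHS]mxE yF ?mxE //= ltn_ord.
move/dimvS; rewrite dim_ortho (eqP freeX) size_tuple codim_sum1.
have : (\dim (V i) <= n)%N.
  by have := dimvS (subvf (V i)); rewrite dimvf /dim /= mul1n.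
have : (\dim (flag i (n - \dim (V i))) <= n)%N.
  by have := dimvS (subvf (flag i (n - \dim (V i)))); rewrite dimvf /dim /= mul1n.
lia.
Qed.

(** Some combination of the entries of row i has leading variable number k. *)
Lemma flag_jump i (k : 'I_n) : (k < d i)%N ->
  exists l : 'rV[K]_n, forall h : 'I_n, (h <= k)%N -> (l *m B i) 0 h = (h == k)%:R.
Proof.
move=> kd; have [|c cE] := @row_space_dual _ _ _ (B i *m pid_mx k.+1) (delta_mx 0 k).
  move=> y; rewrite trmx_mul tr_pid_mx mulmxA => y0.
  have yk : y *m pid_mx k.+1 = 0 :> 'rV[K]_n.
    apply: (indep _ y0) => h dh; rewrite mul_pid_mxE ltnS ifN //.
    by rewrite -ltnNge (leq_trans kd).
  have := mul_pid_mxE y k.+1 k; rewrite yk ltnS leqnn mxE => yk0.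
  by apply/rowP => o; rewrite ord1 -rowE !mxE.
exists c => h hk; have := mul_pid_mxE (c *m B i) k.+1 h.
by rewrite ltnS hk -mulmxA -cE mxE eqxx => <-.
Qed.

(** The points of the component X_A, after moving by g, up to rescaling the rows.
A homogeneous polynomial does not feel the rescaling, and the set becomes a
vector space. *)
Definition on_locus A (X : 'M[K]_(m, n)) := exists z : 'rV[K]_n,
  forall i, row i X *m (B i)^T = if i \in A then z else 0.

Lemma sum_ord_lt (k : nat) : (k <= n)%N -> (\sum_(h < n | (h < k)%N) 1 = k)%N.
Proof. by move=> kn; rewrite (big_ord_narrow kn) sum1_card card_ord. Qed.

(** The coordinates of index at least b_i determine a point of the locus, by
[flag_ortho_eq0], and there are as many of them as the dimension.  To find a
point at which only the coordinate (i0, h0) among them is nonzero, drop the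
equation for (i0, h0): then there are more unknowns than equations, and a
nonzero solution cannot vanish at (i0, h0). *)
Lemma exists_on_locus A b i0 (h0 : 'I_n) : A != set0 -> (b i0 <= h0)%N ->
  (forall i, i \in A -> b i <= d i)%N -> (forall i, i \notin A -> b i = d i) ->
  (\sum_(i in A) (d i - b i) = w A)%N ->
  exists X, [/\ on_locus A X, X i0 h0 != 0
    & forall i (h : 'I_n), (b i <= h)%N -> (i, h) != (i0, h0) -> X i h = 0].
Proof.
move=> A0 bh0 bd bnA sum_w.
pose VA := (\sum_(i in A) V i)%VS.
pose k := \dim (ortho VA).
pose zs (a : 'I_k) : 'rV[K]_n := (vbasis (ortho VA))`_a.
pose U : {set 'I_m * 'I_n} := (i0, h0) |: [set p : 'I_m * 'I_n | (p.2 < b p.1)%N].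
pose I : finType := ('I_k + 'I_#|U|)%type.
pose t (a : I) : 'M[K]_(m, n) := match a with
  | inl a => \matrix_(i, j) if i \in A then - zs a 0 j else 0
  | inr a => \matrix_(i, j) if i == (enum_val a).1 then B i j (enum_val a).2 else 0 end.
(* The unknowns are the coordinates of a vector orthogonal to V_A and the entries
   of X in the positions of U; every equation takes place in T. *)
pose T := (\sum_i (linfun (mulmx (delta_mx i 0 : 'M_(m, 1))) @: ortho (V i))%VS)%VS.
have memT (X : 'M[K]_(m, n)) : (forall i, row i X \in ortho (V i)) -> X \in T.
  move=> rX; apply/memv_sumP; exists (fun i => delta_mx i 0 *m row i X) => [i _|].
    by have := memv_img (linfun (mulmx (delta_mx i 0 : 'M_(m, 1)))) (rX i); rewrite lfunE.
  apply/matrixP => i j; rewrite summxE (bigD1 i) //= mxE big_ord1 !mxE !eqxx mul1r.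
  by rewrite big1 ?addr0 // => l li; rewrite mxE big_ord1 mxE eq_sym (negPf li) mul0r.
have tT a : t a \in T.
  apply: memT => i; apply/orthoP => y yV; apply/rowP => o; rewrite ord1 !mxE.
  case: a => a /=.
    have zo : zs a \in ortho VA by rewrite vbasis_mem // mem_nth // size_tuple.
    have [iA|iA] := boolP (i \in A); last first.
      by apply: big1 => j _; rewrite !mxE (negPf iA) mulr0.
    have yVA : y \in VA by apply: (subvP (sumv_sup i iA (subvv _))).
    move/orthoP/(_ y yVA)/(congr1 (fun M : 'M_1 => M 0 0)): zo; rewrite !mxE => zo.
    apply/eqP; rewrite -oppr_eq0 -sumrN -[X in _ == X]zo; apply/eqP.
    by apply: eq_bigr => j _; rewrite !mxE iA mulrN opprK.
  have := VB yV => /(congr1 (fun M : 'rV_n => M 0 (enum_val a).2)); rewrite !mxE.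
  have [->|ia] := eqVneq i (enum_val a).1.
    by move=> yB; rewrite -[RHS]yB; apply: eq_bigr => j _; rewrite !mxE eqxx.
  by move=> _; apply: big1 => j _; rewrite !mxE (negPf ia) mulr0.
have dimT : (\dim T <= \sum_i d i)%N.
  rewrite /T; apply: leq_trans (dimv_leq_sum _ _ _) _; apply: leq_sum => i _.
  apply: (leq_trans (n := \dim (ortho (V i)))); last by rewrite dim_ortho codim_sum1.
  by rewrite -[leqRHS](limg_ker_dim (linfun (mulmx (delta_mx i 0 : 'M_(m, 1))))) leq_addl.
have b_le i : (b i <= d i)%N.
  by have [/bd //|/bnA ->] := boolP (i \in A).
have cardU : #|U| = (\sum_i b i).+1.
  rewrite cardsU1 inE /= ltnNge bh0 /= add1n; congr (_.+1).
  have -> : (\sum_i b i = \sum_i \sum_(h < n | (h < b i)%N) 1)%N.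
    apply: eq_bigr => i _; rewrite sum_ord_lt //.
    exact: leq_trans (b_le i) (codim_sum1_le i).
  by rewrite pair_big_dep /= -sum1_card; apply: eq_bigl => p; rewrite inE.
have cardI : (\dim T < #|I|)%N.
  rewrite card_sum !card_ord cardU /k dim_ortho -/(w A) addnS ltnS.
  apply: leq_trans dimT _; rewrite -sum_w [X in (_ <= X + _)%N]big_mkcond -big_split /=.
  apply: leq_sum => i _; case: ifP => iA; first by rewrite subnK ?b_le.
  by rewrite bnA ?iA.
have [x [[a xa] x0]] := linear_dependency tT cardI.
pose X : 'M[K]_(m, n) := \matrix_(i, h) \sum_(a < #|U|) x (inr a) *+ (enum_val a == (i, h)).
pose z := \sum_a x (inl a) *: zs a.
have XU a' : X (enum_val a').1 (enum_val a').2 = x (inr a').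
  rewrite mxE (bigD1 a') //= -surjective_pairing eqxx big1 ?addr0 // => a'' na.
  by rewrite (inj_eq enum_val_inj) (negPf na).
have XnU i h : (i, h) \notin U -> X i h = 0.
  move=> nU; rewrite mxE big1 // => a' _; case: eqP => // aE.
  by rewrite -aE enum_valP in nU.
have XB i : row i X *m (B i)^T = if i \in A then z else 0.
  apply/rowP => j; have := congr1 (fun M : 'M_(m, n) => M i j) x0.
  rewrite big_sumType /= !mxE summxE => /eqP; rewrite addrC addr_eq0 => /eqP eX.
  transitivity (\sum_a (x (inr a) *: t (inr a)) i j).
    under eq_bigr => h _ do rewrite !mxE mulr_suml.
    rewrite exchange_big /=; apply: eq_bigr => a' _; rewrite !mxE.
    case: (enum_val a') => i' h' /=; have [->|ii'] := eqVneq i i'; last first.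
      by rewrite mulr0 big1 // => h _; rewrite xpair_eqE (eq_sym i') (negPf ii') mul0r.
    rewrite (bigD1 h') //= eqxx big1 ?addr0 // => h hh'.
    by rewrite xpair_eqE eqxx (eq_sym h') (negPf hh') mul0r.
  transitivity (- \sum_a (x (inl a) *: t (inl a)) i j).
    by move: eX; rewrite summxE.
  rewrite -sumrN; case: ifP => iA.
    rewrite /z summxE; apply: eq_bigr => a' _; rewrite !mxE iA.
    by rewrite mulrN opprK.
  by rewrite mxE big1 // => a' _; rewrite !mxE iA mulr0 oppr0.
exists X; split; first by exists z.
  apply: contraNneq xa => X0.
  have Xb i (h : 'I_n) : (b i <= h)%N -> X i h = 0.
    have [[-> ->] //|ne bh] := eqVneq (i, h) (i0, h0).
    by apply: XnU; rewrite in_setU1 (negPf ne) inE /= ltnNge bh.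
  have rX i (h : 'I_n) : (d i <= h)%N -> row i X 0 h = 0.
    by move=> dh; rewrite mxE Xb // (leq_trans (b_le i)).
  have z0 : z = 0.
    apply: (@flag_ortho_eq0 A b z (fun i => row i X)) => //.
    - by rewrite sum_w.
    - by move=> i iA; rewrite XB iA.
    - by move=> i h _ bh; rewrite mxE Xb.
  have X00 : X = 0.
    apply/row_matrixP => i; rewrite row0; apply: (indep (rX i)).
    by rewrite XB z0 if_same.
  case: (a) => a'; last by rewrite -XU X00 mxE.
  have /freeP/(_ (fun a => x (inl a))) := basis_free (vbasisP (ortho VA)).
  by move/(_ z0) => ->.
by move=> i h bh ne; apply: XnU; rewrite in_setU1 (negPf ne) inE /= ltnNge bh.
Qed.

End GeneralPosition.

(** * Generic conditions on g *)

Section InfiniteField.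
Variable K : fieldType.
Hypothesis K_inf : infinite_field K.

Lemma poly_nonroot (r : {poly K}) : r != 0 -> exists x, r.[x] != 0.
Proof.
move=> r0; have [s [us ss]] : exists s : seq K, uniq s /\ size s = size r.
  elim: (size r) => [|k [s [us ss]]]; first by exists [::].
  by have [x xs] := K_inf s; exists (x :: s); rewrite /= xs us ss.
have /allPn[x _ xr] : ~~ all (root r) s.
  by apply/negP => rs; have := max_poly_roots r0 rs us; rewrite ss ltnn.
by exists x.
Qed.

(** A nonzero polynomial over an infinite field has a nonzero value: keep a nonzero
coefficient with respect to the last variable and use induction. *)
Lemma mpoly_nonroot k (F : {mpoly K[k]}) : F != 0 -> exists v, F.@[v] != 0.
Proof.
elim: k F => [|k IH] F F0.
  exists (fun=> 0); apply: contraNneq F0; rewrite {1}(nvar0_mpolyC F) mevalC => F00.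
  by rewrite (nvar0_mpolyC F) F00 mpolyC0.
have [u uF] : exists u, u \in msupp F.
  case E : (msupp F) => [|u s]; last by exists u; rewrite mem_head.
  by move: F0; rewrite (msuppnil0 E) eqxx.
pose wd := widen_ord (leqnSn k).
pose low (w : 'X_{1..k.+1}) := [multinom w (wd i) | i < k].
have low_inj w w' : low w = low w' -> w ord_max = w' ord_max -> w = w'.
  move=> ww wmax; apply/mnmP => i; have [j ->|->//] := unliftP ord_max i.
  have -> : lift ord_max j = wd j by apply/val_inj; rewrite /= /bump leqNgt ltn_ord.
  by have := congr1 (fun w : 'X_{1..k} => w j) ww; rewrite !mnmE.
pose q := (muni F)`_(u ord_max).
have q0 : q@_(low u) = F@_u.
  rewrite /q muniE coef_sum raddf_sum (bigD1_seq u) ?msupp_uniq //= big1 => [|w wu].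
    by rewrite coefZ coefXn eqxx mulr1 addr0 mcoeffZ mcoeffX eqxx mulr1.
  rewrite coefZ coefXn; case: eqP => [emax|]; last by rewrite mulr0 mcoeff0.
  rewrite mulr1 mcoeffZ mcoeffX; case: eqP => [elow|]; last by rewrite mulr0.
  by rewrite (low_inj w u) ?eqxx in wu.
have [|v vq] := IH q.
  by apply: contraTneq uF => qz; rewrite mcoeff_msupp -q0 qz mcoeff0 eqxx.
pose r := map_poly (meval v) (muni F).
have [|x rx] := @poly_nonroot r.
  by apply: contraNneq vq => r0; rewrite -[_.@[v]]coef_map -/r r0 coef0.
exists (fun i => oapp v x (unlift ord_max i)); apply: contraNneq rx => Fv.
rewrite -[X in _ == X]Fv /r muniE mevalE raddf_sum horner_sum; apply/eqP.
apply: eq_bigr => w _ /=; rewrite map_polyZ map_polyXn hornerZ hornerXn.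
rewrite -[LHS]/((F@_w *: _).@[v] * _) mevalZ mevalX -mulrA; congr (_ * _).
rewrite big_ord_recr /= unlift_none /=; congr (_ * _); apply: eq_bigr => i _.
rewrite mnmE (_ : widen_ord _ i = lift ord_max i) ?liftK /=; last first.
  by apply/val_inj; rewrite /= /bump leqNgt ltn_ord.
congr (_ ^+ w _); apply/val_inj; by rewrite /= /bump leqNgt ltn_ord.
Qed.

End InfiniteField.

Section Generic.
Variables (m n : nat) (K : fieldType).
Local Notation G := ('I_m -> 'M[K]_n).
Local Notation N := #|{: 'I_m * 'I_n * 'I_n}|.
Implicit Types (g : G) (P Q : G -> Prop).

Definition polynomial_fun (phi : G -> K) := exists F : {mpoly K[N]},
  forall g, phi g = F.@[coord g].

Lemma polynomial_fun_const c : polynomial_fun (fun=> c).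
Proof. by exists c%:MP => g; rewrite mevalC. Qed.

Lemma polynomial_fun_coord i k j : polynomial_fun (fun g => g i k j).
Proof.
by exists 'X_(enum_rank (i, k, j)) => g; rewrite mevalXU /coord enum_rankK.
Qed.

Lemma polynomial_funD phi psi : polynomial_fun phi -> polynomial_fun psi ->
  polynomial_fun (fun g => phi g + psi g).
Proof. by move=> [F FE] [H HE]; exists (F + H) => g; rewrite mevalD FE HE. Qed.

Lemma polynomial_funM phi psi : polynomial_fun phi -> polynomial_fun psi ->
  polynomial_fun (fun g => phi g * psi g).
Proof. by move=> [F FE] [H HE]; exists (F * H) => g; rewrite mevalM FE HE. Qed.

Lemma polynomial_funN phi : polynomial_fun phi -> polynomial_fun (fun g => - phi g).
Proof. by move=> [F FE]; exists (- F) => g; rewrite mevalN FE. Qed.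

Lemma polynomial_fun_sum (I : finType) (phi : I -> G -> K) :
  (forall i, polynomial_fun (phi i)) -> polynomial_fun (fun g => \sum_i phi i g).
Proof.
move=> /fin_all_exists[F FE]; exists (\sum_i F i) => g.
by rewrite raddf_sum; apply: eq_bigr => i _; apply: FE.
Qed.

Lemma polynomial_fun_prod (I : finType) (phi : I -> G -> K) :
  (forall i, polynomial_fun (phi i)) -> polynomial_fun (fun g => \prod_i phi i g).
Proof.
move=> /fin_all_exists[F FE]; exists (\prod_i F i) => g.
by rewrite rmorph_prod; apply: eq_bigr => i _; apply: FE.
Qed.

Lemma polynomial_fun_det k (M : G -> 'M[K]_k) :
  (forall i j, polynomial_fun (fun g => M g i j)) ->
  polynomial_fun (fun g => \det (M g)).
Proof.
move=> MP; apply: polynomial_fun_sum => s; apply: polynomial_funM.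
  exact: polynomial_fun_const.
exact: polynomial_fun_prod.
Qed.

(** The property holds on a nonempty open set of tuples of matrices; the matrices
need not be invertible, so that a witness is easier to exhibit. *)
Definition generic P := exists2 F : {mpoly K[N]}, F != 0 &
  forall g, F.@[coord g] != 0 -> P g.

Lemma generic_impl P Q : (forall g, P g -> Q g) -> generic P -> generic Q.
Proof. by move=> PQ [F F0 FP]; exists F => // g /FP /PQ. Qed.

Lemma generic_true P : (forall g, P g) -> generic P.
Proof. by move=> allP; exists 1 => //; apply: oner_neq0. Qed.

Lemma generic_forall (T : finType) (P : T -> G -> Prop) :
  (forall t, generic (P t)) -> generic (fun g => forall t, P t g).
Proof.
move=> genP.
have /fin_all_exists[F FP] t : exists F : {mpoly K[N]}, F != 0 /\
    forall g, F.@[coord g] != 0 -> P t g.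
  by have [F F0 FP] := genP t; exists F.
exists (\prod_t F t) => [|g]; first by apply/prodf_neq0 => t _; case: (FP t).
rewrite rmorph_prod => /prodf_neq0 Fg t; have [_] := FP t.
by apply; apply: Fg.
Qed.

Lemma generic_and P Q : generic P -> generic Q -> generic (fun g => P g /\ Q g).
Proof.
move=> [F F0 FP] [H H0 HQ]; exists (F * H); first by rewrite mulf_neq0.
by move=> g; rewrite mevalM mulf_eq0 negb_or => /andP[/FP Pg /HQ Qg].
Qed.

Lemma generic_neq0 phi g0 : polynomial_fun phi -> phi g0 != 0 ->
  generic (fun g => phi g != 0).
Proof.
move=> [F FE] phi0; exists F => [|g]; last by rewrite FE.
by apply: contraNneq phi0; rewrite FE => ->; rewrite meval0.
Qed.

Definition injective_system (I J : finType) (f : I -> J -> K) :=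
  forall x : I -> K, (forall j, \sum_i x i * f i j = 0) -> forall i, x i = 0.

Lemma injective_systemP (I J : finType) (f : I -> J -> K) :
  injective_system f <->
  row_free (\matrix_(p < #|I|, q < #|J|) f (enum_val p) (enum_val q)).
Proof.
split=> [inj|free x x0 i].
  apply: inj_row_free => v v0; apply/rowP => p; rewrite [RHS]mxE.
  rewrite -[p]enum_valK; apply: (inj (fun i => v 0 (enum_rank i))) => j.
  have := congr1 (fun M : 'rV_ _ => M 0 (enum_rank j)) v0; rewrite !mxE => E.
  rewrite -[RHS]E (reindex _ (onW_bij _ (enum_val_bij I))) /=; apply: eq_bigr => a _.
  by rewrite !mxE enum_valK enum_rankK.
pose v : 'rV[K]_#|I| := \row_p x (enum_val p).
suff v0 : v = 0.
  by have := congr1 (fun M : 'rV_ _ => M 0 (enum_rank i)) v0; rewrite !mxE enum_rankK.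
apply: (row_free_inj free); rewrite mul0mx; apply/rowP => q; rewrite !mxE.
rewrite -[RHS](x0 (enum_val q)) [RHS](reindex _ (onW_bij _ (enum_val_bij I))) /=.
by apply: eq_bigr => a _; rewrite !mxE.
Qed.

(** If a linear system with coefficients polynomial in g has only the zero solution
at g0, then a maximal minor does not vanish at g0, and the system has only the
zero solution wherever this minor does not vanish. *)
Lemma generic_injective_system (I J : finType) (f : G -> I -> J -> K) g0 :
  (forall i j, polynomial_fun (fun g => f g i j)) -> injective_system (f g0) ->
  generic (fun g => injective_system (f g)).
Proof.
move=> fP /injective_systemP; pose M g := \matrix_(p < #|I|, q < #|J|)
  f g (enum_val p) (enum_val q); rewrite -/(M g0) => free0.
have full0 : row_full (M g0)^T by rewrite /row_full mxrank_tr.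
pose s := fullrankfun full0.
have dP : polynomial_fun (fun g => \det (rowsub s (M g)^T)).
  apply: polynomial_fun_det => i j; have [F FE] := fP (enum_val j) (enum_val (s i)).
  by exists F => g; rewrite !mxE FE.
apply: generic_impl (generic_neq0 (g0 := g0) dP _) => [g dg|]; last first.
  by rewrite -unitfE -unitmxE /s fullrowsub_unit.
apply/injective_systemP; rewrite -/(M g) /row_free eqn_leq rank_leq_row /=.
have rk : \rank (rowsub s (M g)^T) = #|I| by apply: mxrank_unit; rewrite unitmxE unitfE.
by rewrite -[leqLHS]rk -[leqRHS]mxrank_tr; apply: mxrankS; apply: rowsub_sub.
Qed.

Lemma generic_open P : infinite_field K -> generic P ->
  exists U, [/\ zariski_open_in_G U, exists g, U g
    & forall g : G, U g -> in_G g /\ P g].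
Proof.
move=> K_inf genP.
have detP i : polynomial_fun (fun g => \det (g i)).
  by apply: polynomial_fun_det => k j; apply: polynomial_fun_coord.
have genG : generic (fun g => forall i, \det (g i) != 0).
  apply: generic_forall => i; apply: (generic_neq0 (g0 := fun=> 1%:M)) => //.
  by rewrite det1 oner_neq0.
have [F F0 FP] := generic_and genG genP.
exists (fun g => in_G g /\ F.@[coord g] != 0); split.
- exists (fun H => H = F) => g; split=> [[gG Fg]|[gG [_ -> Fg]]] //.
  by split=> //; exists F.
- have [v Fv] := mpoly_nonroot K_inf F0.
  pose g (i : 'I_m) := \matrix_(k, j) v (enum_rank (i, k, j)).
  have gv : coord g =1 v.
    move=> q; rewrite /coord; case E : (enum_val q) => [[i k] j].
    by rewrite mxE -E enum_valK.
  have Fg : F.@[coord g] != 0 by rewrite (meval_eq _ gv).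
  exists g; split=> // i; rewrite unitmxE unitfE; exact: (FP g Fg).1.
- by move=> g [gG /FP[]].
Qed.

End Generic.

(** One dimension at a time: replace some U_i by a hyperplane in it that misses a
chosen nonzero vector of the current intersection, which then shrinks. *)
Lemma shrink_bigcap (K : fieldType) (vT : vectType K) (T : finType) (A : {set T})
    (W : T -> {vspace vT}) (e : T -> nat) :
  (forall i, i \in A -> e i <= \dim (W i))%N ->
  exists U : T -> {vspace vT},
    [/\ forall i, (U i <= W i)%VS,
        forall i, i \in A -> \dim (U i) = (\dim (W i) - e i)%N
      & (\dim (\bigcap_(i in A) U i)%VS <=
         \dim (\bigcap_(i in A) W i)%VS - \sum_(i in A) e i)%N].
Proof.
move: {2}(\sum_(i in A) e i)%N (erefl (\sum_(i in A) e i)%N) => k.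
elim: k e => [|k IH] e sum_e e_le.
  exists W; split=> // [i iA|]; last by rewrite sum_e subn0.
  move/eqP: sum_e; rewrite sum_nat_eq0 => /forallP/(_ i)/implyP/(_ iA)/eqP ->.
  by rewrite subn0.
have [i0 i0A ei0] : exists2 i0, i0 \in A & (0 < e i0)%N.
  apply/exists_inP; apply: contraLR (isT : 0 < k.+1)%N; rewrite -sum_e -leqNgt.
  by move=> /exists_inPn h; rewrite leqn0 sum_nat_eq0; apply/forallP => i;
     apply/implyP => iA; have := h i iA; rewrite -leqNgt leqn0.
pose e' i := if i == i0 then (e i).-1 else e i.
have sum_e' : (\sum_(i in A) e' i = k)%N.
  have split_sum F : (\sum_(i in A) F i = F i0 + \sum_(i in A | i != i0) F i)%N.
    by rewrite (bigD1 i0).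
  move: sum_e; rewrite !split_sum {1}/e' eqxx.
  rewrite [in X in _ -> X](eq_bigr e) => [|i /andP[_ /negPf ni]]; last by rewrite /e' ni.
  by case: (e i0) ei0 => //= p _ [].
have [i iA|U [UW dimU dimC]] := IH e' sum_e'.
  by rewrite /e'; case: eqP => _; have := e_le i iA; lia.
set C := (\bigcap_(i in A) U i)%VS in dimC.
have CU i : i \in A -> (C <= U i)%VS by move=> iA; apply: (bigcapv_inf i).
have dimU0 : (0 < \dim (U i0))%N.
  by rewrite dimU // /e' eqxx; have := e_le i0 i0A; lia.
pose x := if C == 0%VS then vpick (U i0) else vpick C.
have x0 : x != 0.
  rewrite /x; case: ifP => [_|]; rewrite vpick0 ?C0 //.
    by rewrite -dimv_eq0 -lt0n.
  by move=> ->.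
have xU : x \in U i0.
  rewrite /x; case: ifP => _; first exact: memv_pick.
  by apply: (subvP (CU _ i0A)); apply: memv_pick.
pose U' i := if i == i0 then (U i0 :\: <[x]>)%VS else U i.
have U'U i : (U' i <= U i)%VS.
  by rewrite /U'; case: eqP => [->|_]; rewrite ?diffvSl.
have xU' : x \notin U' i0.
  rewrite /U' eqxx; apply/negP => xD; have : x \in ((U i0 :\: <[x]>) :&: <[x]>)%VS.
    by rewrite memv_cap xD memv_line.
  by rewrite capv_diff memv0 (negPf x0).
exists U'; split=> [i|i iA|].
- exact: subv_trans (U'U i) (UW i).
- rewrite /U'; case: eqP => [->|/eqP ni]; last by rewrite dimU // /e' (negPf ni).
  have := dimv_cap_compl (U i0) <[x]>; rewrite (capv_idPr _) ?dim_vline ?x0 ?dimU //.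
  by rewrite /e' eqxx; have := e_le i0 i0A; lia.
set C' := (\bigcap_(i in A) U' i)%VS.
have C'C : (C' <= C)%VS.
  by apply/subv_bigcapP => i iA; apply: subv_trans (U'U i); apply: (bigcapv_inf i).
rewrite sum_e; rewrite sum_e' in dimC.
have [C0|C0] := eqVneq C 0%VS; first by move/dimvS: C'C; rewrite C0 dimv0; lia.
suff : (\dim C' < \dim C)%N by lia.
rewrite ltn_neqAle dimvS // andbT; apply/eqP => eq_dim.
have CC' : C' = C by apply/eqP; rewrite eqEdim C'C eq_dim leqnn.
have xC : x \in C by rewrite /x (negPf C0) memv_pick.
move: xU'; rewrite -CC' in xC.
by apply/negP; rewrite negbK; apply: (subvP _ _ xC); apply: (bigcapv_inf i0).
Qed.

(** * A general g is in general position *)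

Section GenericPosition.
Variables (m n : nat) (K : fieldType).
Variables (C : 'I_m -> 'M[K]_n) (V : 'I_m -> {vspace 'rV[K]_n}).
Hypothesis memV : forall i v, (v \in V i) = (v *m C i == 0).
Local Notation w := (codim_sum V).
Local Notation d i := (w [set i]).

(** The coefficient matrices after the action of g. *)
Definition moved (g : 'I_m -> 'M[K]_n) i : 'M[K]_n := C i *m (g i)^T.

Lemma mulmx_moved_eq0 g i v : v \in V i -> v *m moved g i = 0.
Proof. by rewrite memV /moved mulmxA => /eqP ->; rewrite mul0mx. Qed.

Lemma polynomial_fun_moved i j h : polynomial_fun (fun g => moved g i j h).
Proof.
have [F FE] : polynomial_fun (fun g : 'I_m -> 'M[K]_n => \sum_k C i j k * g i h k).
  apply: polynomial_fun_sum => k; apply: polynomial_funM.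
    exact: polynomial_fun_const.
  exact: polynomial_fun_coord.
by exists F => g; rewrite -FE mxE; apply: eq_bigr => k _; rewrite mxE.
Qed.

(** The columns of the moved matrices are arbitrary vectors of the column spaces. *)
Lemma prescribe_moved (y : 'I_m -> 'I_n -> 'rV[K]_n) :
  (forall i h, y i h \in ortho (V i)) ->
  exists g, forall i j h, moved g i j h = y i h 0 j.
Proof.
move=> yV; have cP (p : 'I_m * 'I_n) : exists c : 'rV_n, y p.1 p.2 = c *m (C p.1)^T.
  apply: row_space_dual => x; rewrite trmxK => /eqP; rewrite -memV => xV.
  have /orthoP/(_ x xV) xy := yV p.1 p.2.
  by apply/eqP; rewrite -trmx_eq0 trmx_mul trmxK xy.
have [c cE] := fin_all_exists cP.
exists (fun i => \matrix_(h, k) c (i, h) 0 k) => i j h.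
rewrite (cE (i, h)) !mxE; apply: eq_bigr => k _; by rewrite !mxE mulrC.
Qed.

Lemma sum_free_eq0 (U : {vspace 'rV[K]_n}) (x : 'I_n -> K) :
  (forall h : 'I_n, (\dim U <= h)%N -> x h = 0) ->
  \sum_h x h *: (vbasis U)`_h = 0 -> forall h, x h = 0.
Proof.
move=> x0 sx h; have dimU : (\dim U <= n)%N.
  by have := dimvS (subvf U); rewrite dimvf /dim /= mul1n.
have [hU|/x0 //] := ltnP h (\dim U).
have /freeP/(_ (fun k => x (widen_ord dimU k))) := basis_free (vbasisP U).
rewrite -[X in X = 0 -> _](big_ord_narrow (F := fun k => x k *: (vbasis U)`_k) dimU).
have -> : \sum_(k < n | (k < \dim U)%N) x k *: (vbasis U)`_k = 0.
  rewrite -[RHS]sx [RHS](bigID (fun k : 'I_n => k < \dim U)%N) /=.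
  by rewrite [X in _ = _ + X]big1 ?addr0 // => k; rewrite -leqNgt => /x0 ->; rewrite scale0r.
by move=> /(_ erefl (Ordinal hU)) <-; congr x; apply/val_inj.
Qed.

Lemma vbasis_nth_mem (U : {vspace 'rV[K]_n}) (h : nat) : (vbasis U)`_h \in U.
Proof.
have [hU|hU] := ltnP h (\dim U); last by rewrite nth_default ?mem0v // size_tuple.
by rewrite vbasis_mem // mem_nth // size_tuple.
Qed.

Lemma generic_independent_columns :
  generic (fun g => independent_columns V (moved g)).
Proof.
suff gen i : generic (fun g : 'I_m -> 'M[K]_n => forall x : 'rV[K]_n,
    (forall h : 'I_n, (d i <= h)%N -> x 0 h = 0) -> x *m (moved g i)^T = 0 -> x = 0).
  exact: generic_impl (generic_forall gen) => g.
pose f g (h : 'I_n) (q : 'I_n + 'I_n) : K := match q with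
  | inl j => moved g i j h | inr h' => ((h == h') && (d i <= h)%N)%:R end.
have [g0 g0E] := @prescribe_moved (fun i h => (vbasis (ortho (V i)))`_h)
  (fun i h => vbasis_nth_mem _ h).
have := @generic_injective_system m n K _ _ f g0; case=> [h [j|h']||F F0 FP].
- exact: polynomial_fun_moved.
- exact: polynomial_fun_const.
- move=> x xf; apply: (@sum_free_eq0 (ortho (V i))) => [h|].
    rewrite dim_ortho -codim_sum1 => dh; have := xf (inr h).
    rewrite (bigD1 h) //= eqxx dh mulr1 big1 ?addr0 // => k kh.
    by rewrite (negPf kh) mulr0.
  apply/rowP => j; rewrite summxE mxE -[RHS](xf (inl j)); apply: eq_bigr => h _.
  by rewrite mxE /= g0E.
exists F => // g /FP inj x x0 xB; apply/rowP => h; rewrite mxE.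
apply: (inj (fun h => x 0 h)) => -[j|h'] /=.
  have := congr1 (fun M : 'rV_n => M 0 j) xB; rewrite !mxE => E.
  by rewrite -[RHS]E; apply: eq_bigr => k _; rewrite [in RHS]mxE.
rewrite (bigD1 h') //= eqxx big1 ?addr0 => [|k /negPf ->]; last by rewrite mulr0.
by case: leqP => [/x0 ->|_]; rewrite ?mul0r ?mulr0.
Qed.

Lemma bigcap_ortho (A : {set 'I_m}) :
  (\dim (\bigcap_(i in A) ortho (V i))%VS <= w A)%N.
Proof.
rewrite /codim_sum -dim_ortho; apply: dimvS; apply/subvP => z zV.
apply/orthoP => _ /memv_sumP[v vV ->]; rewrite mulmx_suml big1 // => i iA.
have /orthoP : z \in ortho (V i) by apply: (subvP _ _ zV); apply: (bigcapv_inf i).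
by apply; apply: vV.
Qed.

(** The dual statement is an injective linear system: if the vectors
sum_h x(i,h) col_h(B i), restricted to h < b_i, agree for all i in A, then x = 0.
Its entries are polynomials in g, and [shrink_bigcap] provides a g for which it
holds. *)
Lemma generic_spanning_flag (A : {set 'I_m}) (b : 'I_m -> nat) : A != set0 ->
  (forall i, i \in A -> b i <= d i)%N -> (w A <= \sum_(i in A) (d i - b i))%N ->
  generic (fun g => (\sum_(i in A) flag (moved g) i (b i))%VS = fullv).
Proof.
move=> /set0Pn[i1 i1A] bd wA.
(* The equations inl compare row q.1 with row i1; the equations inr restrict the
   support of x. *)
pose f g (p : 'I_m * 'I_n) (q : ('I_m * 'I_n) + ('I_m * 'I_n)) : K := match q with
  | inl q => if q.1 \in A then (p.1 == q.1)%:R * moved g q.1 q.2 p.2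
                            - (p.1 == i1)%:R * moved g i1 q.2 p.2 else 0
  | inr q => ((p == q) && ((p.1 \notin A) || (b p.1 <= p.2)%N))%:R end.
have sum_pick g (x : 'I_m * 'I_n -> K) k j :
    \sum_p x p * ((p.1 == k)%:R * moved g k j p.2) = \sum_h x (k, h) * moved g k j h.
  rewrite (eq_bigr (fun p => x (p.1, p.2) * ((p.1 == k)%:R * moved g k j p.2)));
    last by case.
  rewrite -(pair_bigA _ (fun i h => x (i, h) * ((i == k)%:R * moved g k j h))) /=.
  rewrite (bigD1 k) //= eqxx [X in _ + X]big1 ?addr0 => [|i /negPf ik]; last first.
    by apply: big1 => h _; rewrite ik mul0r mulr0.
  by apply: eq_bigr => h _; rewrite mul1r.
have sum_inl g x q : q.1 \in A -> \sum_p x p * f g p (inl q) =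
    \sum_h x (q.1, h) * moved g q.1 q.2 h - \sum_h x (i1, h) * moved g i1 q.2 h.
  move=> qA; rewrite -!sum_pick -sumrB; apply: eq_bigr => p _.
  by rewrite /f qA mulrBr.
have sum_inr g x q : \sum_p x p * f g p (inr q) =
    x q * ((q.1 \notin A) || (b q.1 <= q.2)%N)%:R.
  by rewrite (bigD1 q) //= eqxx big1 ?addr0 // => p /negPf ->; rewrite mulr0.
have e_le i : i \in A -> (d i - b i <= \dim (ortho (V i)))%N.
  by move=> _; rewrite dim_ortho -codim_sum1 leq_subr.
have [U [UW dimU capU]] := shrink_bigcap e_le.
have {}capU : (\bigcap_(i in A) U i)%VS = 0%VS.
  by apply/eqP; rewrite -dimv_eq0; have := bigcap_ortho A; lia.
have dU i : i \in A -> \dim (U i) = b i.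
  by move=> iA; rewrite dimU // dim_ortho -codim_sum1 subKn // bd.
have [g0 g0E] := @prescribe_moved (fun i h => (vbasis (U i))`_h)
  (fun i h => subvP (UW i) _ (vbasis_nth_mem (U i) h)).
have := @generic_injective_system m n K _ _ f g0; case=> [p [q|q]||F F0 FP].
- rewrite /f; case: (q.1 \in A); last exact: polynomial_fun_const.
  apply: polynomial_funD; last apply: polynomial_funN; apply: polynomial_funM;
    by [exact: polynomial_fun_const | exact: polynomial_fun_moved].
- exact: polynomial_fun_const.
- move=> x xf.
  have x0 i (h : 'I_n) : (i \notin A) || (b i <= h)%N -> x (i, h) = 0.
    by move=> out; have := xf (inr (i, h)); rewrite sum_inr /= out mulr1.
  pose z i := \sum_h x (i, h) *: (vbasis (U i))`_h.
  have zE i : i \in A -> z i = z i1.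
    move=> iA; apply/rowP => j; have := xf (inl (i, j)).
    rewrite sum_inl //= => /eqP; rewrite subr_eq0 => /eqP E.
    rewrite !summxE; transitivity (\sum_h x (i, h) * moved g0 i j h).
      by apply: eq_bigr => h _; rewrite g0E mxE.
    by rewrite E; apply: eq_bigr => h _; rewrite g0E [RHS]mxE.
  have z0 : z i1 = 0.
    apply/eqP; rewrite -memv0 -capU; move: (z i1) zE => z1 zE.
    have : (<[z1]> <= \bigcap_(i in A) U i)%VS; last by rewrite -memvE.
    apply/subv_bigcapP => i iA; rewrite -memvE -(zE i iA).
    by apply: memv_suml => h _; rewrite memvZ // vbasis_nth_mem.
  move=> [i h]; have [iA|iA] := boolP (i \in A); last by rewrite x0 ?iA.
  apply: (@sum_free_eq0 (U i) (fun h => x (i, h))) => [h'|].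
    by rewrite dU // => bh; rewrite x0 // bh orbT.
  by rewrite -/(z i) zE.
exists F => // g /FP inj; apply: fullv_ortho => z /orthoP zF.
have cP i : exists c : 'rV[K]_n, i \in A -> z = c *m (pid_mx (b i) *m (moved g i)^T).
  have [iA|iA] := boolP (i \in A); last by exists 0.
  have [|c cE] := @row_space_dual K n n (pid_mx (b i) *m (moved g i)^T) z; last by exists c.
  move=> y; rewrite trmx_mul trmxK tr_pid_mx => yF.
  have yf : y \in flag (moved g) i (b i) by rewrite memv_ker lfunE /= yF.
  have yz : y *m z^T = 0.
    by apply: zF; apply: (subvP _ _ yf); apply: (sumv_sup i).
  by apply/eqP; rewrite -trmx_eq0 trmx_mul trmxK yz.
have [c cE] := fin_all_exists cP.
pose x (p : 'I_m * 'I_n) := if p.1 \in A then (c p.1 *m pid_mx (b p.1)) 0 p.2 else 0.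
have zE i j : i \in A -> z 0 j = \sum_h x (i, h) * moved g i j h.
  move=> iA; rewrite {1}(cE i iA) mulmxA mxE; apply: eq_bigr => h _.
  by rewrite /x /= iA [_^T _ _]mxE.
have x0 := inj x; apply/rowP => j; rewrite (zE _ _ i1A) mxE big1 // => h _.
rewrite x0 ?mul0r // => -[q|q].
  have [qA|qA] := boolP (q.1 \in A); first by rewrite sum_inl // -!zE // subrr.
  by apply: big1 => p _; rewrite /f (negPf qA) mulr0.
rewrite sum_inr /x; case: ifP => qA /=; last by rewrite mul0r.
by rewrite mul_pid_mxE ltnNge; case: leqP => _; rewrite ?mul0r ?mulr0.
Qed.

Lemma generic_spanning_flags : generic (fun g => spanning_flags V (moved g)).
Proof.
pose bound := n.+1; pose b' (b : {ffun 'I_m -> 'I_bound}) i : nat := b i.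
have gen (Ab : {set 'I_m} * {ffun 'I_m -> 'I_bound}) :
  generic (fun g => Ab.1 != set0 -> (forall i, i \in Ab.1 -> b' Ab.2 i <= d i)%N ->
    (w Ab.1 <= \sum_(i in Ab.1) (d i - b' Ab.2 i))%N ->
    (\sum_(i in Ab.1) flag (moved g) i (b' Ab.2 i))%VS = fullv).
  case: Ab => A b /=.
  have [A0|A0] := boolP (A != set0); last by apply: generic_true.
  have [/forall_inP bd|bd] := boolP [forall i in A, b' b i <= d i]%N; last first.
    by apply: generic_true => g _ h; case/negP: bd; apply/forall_inP.
  have [wA|wA] := boolP (w A <= \sum_(i in A) (d i - b' b i))%N; last first.
    by apply: generic_true.
  by apply: generic_impl (generic_spanning_flag A0 bd wA) => g.
apply: generic_impl (generic_forall gen) => g gP A b A0 bd wA.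
pose c : {ffun 'I_m -> 'I_bound} := [ffun i => inord (b i)].
have cE i : i \in A -> b' c i = b i.
  move=> iA; rewrite /b' ffunE inordK // ltnS.
  by apply: leq_trans (bd i iA) _; apply: codim_sum1_le.
rewrite -(gP (A, c)) //=.
- by apply: eq_bigr => i iA; rewrite cE.
- by move=> i iA; rewrite cE ?bd.
- by rewrite (eq_bigr (fun i => d i - b i)%N) // => i iA; rewrite cE.
Qed.

End GenericPosition.

(** * Standard monomials are independent on a component *)

(** A vector space over an infinite field is irreducible: on the line that joins a
point where f1 does not vanish to any other point, f1 f2 restricts to the zero
polynomial in one variable, hence so does f2. *)
Lemma line_factor (K : fieldType) k (f1 f2 : {mpoly K[k]}) (a c : 'I_k -> K) :
  infinite_field K ->
  (forall s, (f1 * f2).@[fun r => a r + c r * s] = 0) -> f1.@[a] != 0 ->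
  f2.@[fun r => a r + c r] = 0.
Proof.
move=> K_inf f0 f1a; pose line r : {poly K} := (a r)%:P + (c r)%:P * 'X.
have E f s : (mmap polyC line f).[s] = f.@[fun r => a r + c r * s].
  rewrite /mmap horner_sum mevalE; apply: eq_bigr => u _.
  rewrite hornerM hornerC /mmap1 horner_prod; congr (_ * _); apply: eq_bigr => r _.
  by rewrite horner_exp !hornerE.
have /eqP : mmap polyC line f1 * mmap polyC line f2 = 0.
  apply/eqP/negPn/negP => /(poly_nonroot K_inf)[s]; rewrite hornerM !E.
  by rewrite -mevalM f0 eqxx.
rewrite mulf_eq0 => /orP[/eqP L1|/eqP L2].
  move: f1a; rewrite (meval_eq (v2 := fun r => a r + c r * 0)) -?E ?L1 ?horner0 ?eqxx //.
  by move=> r; rewrite mulr0 addr0.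
by have := E f2 1; rewrite L2 horner0 => E1; rewrite [RHS]E1; apply: meval_eq => r; rewrite mulr1.
Qed.

Section LocusIndependence.
Variables (m n : nat) (K : fieldType).
Hypothesis K_inf : infinite_field K.
Variables (V : 'I_m -> {vspace 'rV[K]_n}) (B : 'I_m -> 'M[K]_n).
Hypothesis VB : forall i v, v \in V i -> v *m B i = 0.
Hypothesis indep : independent_columns V B.
Hypothesis spans : spanning_flags V B.
Local Notation S := {mpoly K[m * n]}.
Local Notation mon := 'X_{1.. m * n}.
Local Notation degree := {ffun 'I_m -> nat}.
Local Notation w := (codim_sum V).
Local Notation d i := (w [set i]).
Variable A : {set 'I_m}.
Hypothesis A_neq0 : A != set0.
Implicit Types (f : S) (u : mon) (X : 'M[K]_(m, n)).

Definition at_point X (q : 'I_(m * n)) : K := mxvec X 0 q.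

(** Vanishing on the locus is an ideal which contains the moved ideal of minors. *)
Definition vanishes f := forall X, on_locus B A X -> f.@[at_point X] = 0.

Definition cut (b : 'I_m -> nat) X := forall i (h : 'I_n), (b i <= h)%N -> X i h = 0.

(** A monomial standard for A, with facet d_i - beta_i - 1, that moreover lies in the
variables of index less than b_i, the ones that survive the cut. *)
Definition in_window (b : 'I_m -> nat) u := exists beta : 'I_m -> nat,
  [/\ forall i (j : 'I_n), u (mxvec_index i j) != 0%N -> (beta i <= j < b i)%N,
      forall i, i \in A -> (beta i < b i)%N,
      forall i, i \notin A -> (d i <= beta i <= b i)%N
    & (\sum_(i in A) (d i - (beta i).+1) < w A)%N].

Lemma on_locus_line X Y s : on_locus B A X -> on_locus B A Y ->
  on_locus B A (X + s *: (Y - X)).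
Proof.
move=> [z zE] [z' z'E]; exists (z + s *: (z' - z)) => i.
rewrite raddfD /= linearZ /= raddfB /= mulmxDl -scalemxAl mulmxBl zE z'E.
by case: ifP => // _; rewrite subrr scaler0 addr0.
Qed.

Lemma on_locus0 : on_locus B A 0.
Proof. by exists 0 => i; rewrite row0 mul0mx if_same. Qed.

Lemma cut_line b X Y s : cut b X -> cut b Y -> cut b (X + s *: (Y - X)).
Proof. by move=> cX cY i h bh; rewrite !mxE cX // cY // subr0 mulr0 addr0. Qed.

(** The numerical condition on u leaves room for one more cut, in row i0, before the
locus is exhausted. *)
Lemma window_point b u i0 (h0 j0 : 'I_n) :
  in_window b u -> b i0 = h0.+1 -> u (mxvec_index i0 j0) != 0%N ->
  exists X, [/\ on_locus B A X, cut b X & X i0 h0 != 0].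
Proof.
move=> [beta [ub bA bnA sumA]] bi0 uj0.
have /andP[j0beta j0b] := ub _ _ uj0.
pose b' i := if i == i0 then h0 : nat else b i.
have b'b i : (b' i <= b i)%N by rewrite /b'; case: eqP => [->|//]; rewrite bi0.
pose c i := (d i - b' i)%N.
have sumc : (\sum_(i in A) c i <= w A)%N.
  apply: leq_trans sumA; rewrite -addn1.
  apply: (@leq_trans (\sum_(i in A) (d i - (beta i).+1 + (i == i0)))).
    apply: leq_sum => i iA; rewrite /c /b'; case: eqP => [->|_].
      by move: j0beta j0b; rewrite bi0; lia.
    by have := bA i iA; lia.
  rewrite big_split leq_add2l /= -big_mkcondr /=.
  have [i0A|i0A] := boolP (i0 \in A).
    rewrite (eq_bigl (pred1 i0)) ?big_pred1_eq // => i /=.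
    by case: eqP => [->|]; rewrite ?i0A ?andbF.
  by rewrite big_pred0 // => i; case: eqP => [->|]; rewrite ?(negPf i0A) ?andbF.
have [i1 i1A] := set0Pn _ A_neq0.
pose e i := (c i + (if i == i1 then w A - \sum_(i in A) c i else 0))%N.
have sume : (\sum_(i in A) e i = w A)%N.
  rewrite big_split /= -big_mkcondr /= [X in (_ + X)%N](big_pred1 i1) => [|i /=].
    by rewrite subnKC.
  by case: eqP => [->|]; rewrite ?i1A ?andbF.
have e_le i : i \in A -> (e i <= d i)%N.
  move=> iA; apply: (@leq_trans (w A)); last by apply: codim_sum_anti; rewrite sub1set.
  by rewrite -sume (bigD1 i) //= leq_addr.
pose bs i := if i \in A then (d i - e i)%N else d i.
have bs_b' i : (bs i <= b' i)%N.
  rewrite /bs; case: ifPn => iA; first by rewrite /e /c; lia.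
  have /andP[d_beta beta_b] := bnA i iA; rewrite /b'; case: eqP => [ii|_]; last first.
    exact: leq_trans d_beta beta_b.
  by apply: leq_trans d_beta _; rewrite ii -ltnS -bi0; apply: leq_ltn_trans j0beta j0b.
have [||i iA|i iA||X [XA X0 Xcut]] := @exists_on_locus _ _ _ V B VB indep spans A bs i0 h0.
- exact: A_neq0.
- by have := bs_b' i0; rewrite /b' eqxx.
- by rewrite /bs iA leq_subr.
- by rewrite /bs (negPf iA).
- by rewrite -sume; apply: eq_bigr => i iA; rewrite /bs iA subKn // e_le.
exists X; split=> // i h bh; apply: Xcut.
  by apply: leq_trans (leq_trans (bs_b' i) (b'b i)) bh.
by apply: contraTneq bh => -[-> ->]; rewrite bi0 ltnn.
Qed.

(** Induction on the number of surviving variables and on the degree.  Let x be the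
last surviving variable of a row i0 in which f has positive degree.  The
monomials of f without x remain standard after cutting with x = 0, hence cancel;
so f = x f1, and f1 vanishes as well because x does not vanish identically. *)
Lemma window_eq0 N b (dg : degree) f :
  (\sum_i b i + \sum_i dg i < N)%N -> (forall i, b i <= n)%N ->
  homogeneous dg f -> (forall u, u \in msupp f -> in_window b u) ->
  (forall X, on_locus B A X -> cut b X -> f.@[at_point X] = 0) -> f = 0.
Proof.
elim: N b dg f => [|N IH] b dg f // le_N bn hf fb f0.
have [/existsP[i0 di0]|/existsPn dg0] := boolP [exists i, 0 < dg i]%N; last first.
  have fE : f = (f@_0%MM)%:MP.
    apply/mpolyP => u; rewrite mcoeffC; have [->|u0] := eqVneq u 0%MM; first by rewrite mulr1.
    rewrite mulr0; apply: memN_msupp_eq0; apply: contra u0 => /hf ud.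
    rewrite -mdeg_eq0 mdeg_mon_degree ud sum_nat_eq0.
    by apply/forallP => i; have := dg0 i; rewrite -eqn0Ngt.
  have := f0 0 on_locus0 (fun i h _ => mxE _ _ _ _).
  by rewrite fE mevalC => ->; rewrite mpolyC0.
case E : (msupp f) => [|u0 s]; first exact: msuppnil0.
have u0f : u0 \in msupp f by rewrite E mem_head.
have row_neq0 u : u \in msupp f -> exists j : 'I_n, u (mxvec_index i0 j) != 0%N.
  move=> /hf ud; apply/existsP; apply: contraLR di0 => /existsPn u0'.
  rewrite -leqNgt leqn0 -ud ffunE sum_nat_eq0; apply/forallP => j.
  by have := u0' j; rewrite negbK.
have [j0 uj0] := row_neq0 _ u0f.
have bi0_gt0 : (0 < b i0)%N.
  have [beta [ub _ _ _]] := fb _ u0f.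
  by have /andP[_] := ub _ _ uj0; apply: leq_ltn_trans.
have lt_h : ((b i0).-1 < n)%N by rewrite prednK.
pose h0 : 'I_n := Ordinal lt_h.
have bi0 : b i0 = h0.+1 by rewrite /= prednK.
pose q0 := mxvec_index i0 h0.
pose b' i := if i == i0 then h0 : nat else b i.
pose f0' := \sum_(u <- msupp f | u q0 == 0%N) f@_u *: 'X_[u].
have f0'E u : f0'@_u = if u q0 == 0%N then f@_u else 0 by apply: mcoeff_restrict.
have f0'_supp u : u \in msupp f0' -> (u q0 == 0%N) && (u \in msupp f).
  by rewrite !mcoeff_msupp f0'E; case: (u q0 == 0%N); rewrite ?eqxx.
have f0'0 : f0' = 0.
  apply: (IH b' dg) => [|i|u /f0'_supp/andP[_ /hf]|u /f0'_supp/andP[/eqP uq uf]|X XA Xb'] //.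
  - rewrite -ltnS; apply: leq_trans le_N; rewrite ltnS ltn_add2r.
    rewrite (bigD1 i0) //= [ltnRHS](bigD1 i0) //=.
    rewrite {1}/b' eqxx -addSn -bi0 leq_add2l; apply: leq_sum => i ii.
    by rewrite /b' (negPf ii).
  - by rewrite /b'; case: eqP => // _; apply: ltnW.
  - have [beta [ub bA bnA sumA]] := fb u uf; exists beta.
    have ub' i j : u (mxvec_index i j) != 0%N -> (beta i <= j < b' i)%N.
      move=> uij; have /andP[-> jb] := ub i j uij; rewrite /b' /=; case: eqP => // ii.
      rewrite ltn_neqAle -ltnS -bi0 -ii jb andbT.
      apply: contraNneq uij => jh.
      have -> : j = h0 by apply: val_inj; rewrite /= jh ii.
      by rewrite ii -/q0 uq.
    have [j uj] := row_neq0 u uf; have lt_j := ub' _ _ uj.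
    split=> // i iA.
      have [->|ii] := eqVneq i i0; last by rewrite /b' (negPf ii) bA.
      by case/andP: lt_j; apply: leq_ltn_trans.
    have /andP[-> bb] := bnA i iA; have [->|ii] := eqVneq i i0.
      by case/andP: lt_j => h1 h2; apply/ltnW/(leq_ltn_trans h1).
    by rewrite /b' (negPf ii).
  - have X0 : at_point X q0 = 0.
      by rewrite /at_point mxvecE Xb' // /b' eqxx.
    have Xb : cut b X.
      move=> i h bh; apply: Xb'; apply: leq_trans bh; rewrite /b'.
      by case: eqP => [->|//]; rewrite bi0.
    rewrite -(f0 X XA Xb) /f0' raddf_sum /= [in RHS](mpolyE f) raddf_sum /=.
    rewrite [RHS](bigID (fun u : mon => u q0 == 0%N)) /=.
    rewrite [X in _ = _ + X]big1 ?addr0 // => u uq.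
    by rewrite mevalZ mevalX (bigD1 q0) //= X0 expr0n (negPf uq) mul0r mulr0.
have fq u : u \in msupp f -> (0 < u q0)%N.
  rewrite mcoeff_msupp lt0n; apply: contra => uq.
  by have := f0'E u; rewrite f0'0 mcoeff0 uq => <-.
pose f1 := \sum_(u <- msupp f) f@_u *: 'X_[u - U_(q0)] : S.
have fE : f = f1 * 'X_q0.
  rewrite {1}(mpolyE f) mulr_suml big_seq [RHS]big_seq; apply: eq_bigr => u uf.
  by rewrite -scalerAl -mpolyXD submK // lep1mP -lt0n fq.
have f1_supp u : u \in msupp f1 -> (u + U_(q0))%MM \in msupp f.
  have fu : f@_(u + U_(q0)) = f1@_u by rewrite {1}fE addmC mcoeffMX.
  by rewrite !mcoeff_msupp fu.
suff f10 : f1 = 0 by rewrite fE f10 mul0r.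
pose dg1 : degree := [ffun i => (dg i - (i == i0))%N].
apply: (IH b dg1) => // [|u uf1|u uf1|X XA Xb].
- rewrite -ltnS; apply: leq_trans le_N; rewrite ltnS -addnS leq_add2l.
  rewrite (bigD1 i0) //= [ltnRHS](bigD1 i0) //= ffunE eqxx subn1.
  rewrite -addSn prednK // leq_add2l; apply: leq_sum => i ii.
  by rewrite ffunE (negPf ii) subn0.
- apply/ffunP => i; have := hf _ (f1_supp _ uf1).
  move=> /(congr1 (fun D : degree => D i)); rewrite mon_degreeD mon_degreeU.
  by rewrite [in X in X -> _]ffunE => Ei; rewrite [RHS]ffunE -Ei [unit_degree _ _]ffunE addnK.
- have [beta [ub bA bnA sumA]] := fb _ (f1_supp _ uf1); exists beta; split=> // i j uij.
  by apply: ub; rewrite mnmDE addn_eq0 negb_and uij.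
have [Y [YA Yb Y0]] := window_point (fb _ u0f) bi0 uj0.
rewrite (meval_eq (v2 := fun r => at_point Y r + at_point (X - Y) r)); last first.
  by move=> r; case/mxvec_indexP: r => i j; rewrite /at_point !mxvecE !mxE addrCA subrr addr0.
apply: (@line_factor _ _ ('X_q0)) => // [s'|]; last first.
  by rewrite mevalXU /at_point mxvecE.
rewrite mulrC -fE -[RHS](f0 (Y + s' *: (X - Y))).
- apply: meval_eq => r; case/mxvec_indexP: r => i j.
  by rewrite /at_point !mxvecE !mxE [s' * _]mulrC.
- exact: on_locus_line.
- exact: cut_line.
Qed.

End LocusIndependence.

(** * Leading monomials of determinants *)

Lemma det_mx22 (R : comNzRingType) (M : 'M[R]_2) :
  \det M = M 0 0 * M 1 1 - M 0 1 * M 1 0.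
Proof.
rewrite (expand_det_row _ 0) !big_ord_recl big_ord0 addr0 /cofactor !det_mx11 !mxE /=.
rewrite !addn0 expr0 mul1r expr1 mulN1r mulrN.
by congr (_ * M _ _ - M _ _ * M _ _); apply/val_inj.
Qed.

(** Pair the permutation s with its composition with the transposition of the two
columns: the two terms differ by a multiple of a 2-minor. *)
Lemma det_two_columns (R : comNzRingType) (I : R -> Prop) k (M : 'M[R]_k) (j0 j1 : 'I_k) :
  is_ideal I -> j0 != j1 ->
  (forall i i', I (M i j0 * M i' j1 - M i' j0 * M i j1)) -> I (\det M).
Proof.
move=> Iid j01 M01; rewrite -det_tr /determinant.
under eq_bigr => s _ do under eq_bigr => j _ do rewrite mxE.
pose F (s : 'S_k) := (-1) ^+ s * \prod_j M (s j) j; pose t := tperm j0 j1.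
rewrite (bigID (fun s : 'S_k => odd_perm s)) /=.
rewrite [X in X + _](reindex_inj (mulgI t)) /=
  [X in X + _](eq_bigl (fun s : 'S_k => ~~ odd_perm s)); last first.
  by move=> s /=; rewrite odd_permM odd_tperm j01.
rewrite -big_split /=; apply: ideal_sum => // s es.
rewrite odd_permM odd_tperm j01 (negPf es) /= expr1 expr0 mul1r mulN1r.
rewrite (bigD1 j0) //= (bigD1 j1) 1?eq_sym //= [X in _ + X](bigD1 j0) //=.
rewrite [X in _ + _ * X](bigD1 j1) 1?eq_sym //= !permM tpermL tpermR.
under eq_bigr => j /andP[jj0 jj1] do rewrite permM tpermD 1?eq_sym //.
set P := \prod_(i < k | _) _.
have -> : - (M (s j1) j0 * (M (s j0) j1 * P)) + M (s j0) j0 * (M (s j1) j1 * P) =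
    P * (M (s j0) j0 * M (s j1) j1 - M (s j1) j0 * M (s j0) j1).
  by rewrite !mulrA -mulNr -mulrDl mulrC addrC.
by case: Iid => _ _; apply.
Qed.

Section LeadingTerm.
Variables (m n : nat) (K : fieldType).
Local Notation S := {mpoly K[m * n]}.
Local Notation mon := 'X_{1.. m * n}.
Local Notation degree := {ffun 'I_m -> nat}.
Variables (A : {set 'I_m}) (b : 'I_m -> 'I_n) (c : 'I_m -> 'I_m -> 'I_n -> K).
Hypothesis c_b : forall i j (h : 'I_n), i \in A -> j \in A -> (h <= b j)%N ->
  c i j h = ((i == j) && (h == b j))%:R.

(** A matrix whose column j, for j in A, consists of linear forms in row j of the
variables.  It is completed by the identity outside A to keep a fixed size. *)
Definition form_mx : 'M[S]_m := \matrix_(i, j)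
  if (i \in A) && (j \in A) then \sum_h c i j h *: xvar K j h else (i == j)%:R.

Let e i j h : K := if j \in A then (if i \in A then c i j h else 0)
                   else ((i == j) && (h == b j))%:R.

(** Multilinearity in the columns: choose one variable in each column of A. *)
Lemma det_form_mx : \det form_mx =
  \sum_(f : {ffun 'I_m -> 'I_n}) \det (\matrix_(i, j) e i j (f j)) *: 'X_[gin_mon A f].
Proof.
have entryE i j : form_mx i j =
    \sum_h e i j h *: 'X_[if j \in A then U_(mxvec_index j h) else 0]%MM.
  rewrite mxE /e; have [jA|jA] := boolP (j \in A); last first.
    rewrite andbF (bigD1 (b j)) //= eqxx andbT big1 => [|h /negPf ->]; last first.
      by rewrite andbF scale0r.
    by rewrite addr0 mpolyX0; case: eqP; rewrite ?scale1r ?scale0r.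
  rewrite andbT; case: ifPn => // iA; rewrite big1 => [|h _]; last by rewrite scale0r.
  by case: eqP => // ij; rewrite ij jA in iA.
rewrite -[in LHS]det_tr [in LHS]/determinant.
under eq_bigr => s _.
  under eq_bigr => j _ do rewrite mxE entryE.
  rewrite bigA_distr_bigA mulr_sumr; over.
rewrite exchange_big /=; apply: eq_bigr => f _.
rewrite -det_tr /determinant scaler_suml; apply: eq_bigr => s _.
rewrite -mul_mpolyC mpolyCM -mulrA; congr (_ * _).
  by case: odd_perm; rewrite ?expr0 ?expr1 ?mpolyCN mpolyC1.
rewrite mul_mpolyC scaler_prod; congr (_ *: _).
  by apply: eq_bigr => j _; rewrite !mxE.
rewrite mprodXE; congr 'X_[_]; rewrite /gin_mon [RHS]big_mkcond.
by apply: eq_bigr => j _.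
Qed.

Lemma gin_mon_degree (f : 'I_m -> 'I_n) :
  mon_degree (gin_mon A f) = [ffun i => (i \in A) : nat].
Proof.
apply/ffunP => i; rewrite !ffunE.
under eq_bigr => j _ do rewrite gin_monE.
case: (i \in A) => /=; last by rewrite big1.
by rewrite (bigD1 (f i)) //= eqxx big1 // => j /negPf; rewrite eq_sym => ->.
Qed.

Lemma det_form_mx_coef0 (f : {ffun 'I_m -> 'I_n}) :
  \det (\matrix_(i, j) e i j (f j)) != 0 ->
  (forall j, j \in A -> b j <= f j)%N /\ (forall j, j \notin A -> f j = b j).
Proof.
have zero_col j : (forall i, e i j (f j) = 0) -> \det (\matrix_(i, j) e i j (f j)) = 0.
  by move=> e0; rewrite (expand_det_col _ j) big1 // => i _; rewrite mxE e0 mul0r.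
move=> det0; split=> j jA.
  rewrite leqNgt; apply: contra det0 => fb; apply/eqP/(zero_col j) => i.
  rewrite /e jA; case: ifPn => // iA; rewrite c_b ?(ltnW fb) //.
  by case: (f j =P b j) fb => [->|]; rewrite ?ltnn ?andbF.
apply: contraNeq det0 => fb; apply/eqP/(zero_col j) => i.
by rewrite /e (negPf jA) (negPf fb) andbF.
Qed.

(** A choice f of variables with f j < b j for some j has a zero column, so that all
monomials use indices at least b; for f = b the matrix of coefficients is the
identity. *)
Lemma leading_det_form_mx tau : term_order tau ->
  leading_mon tau (\det form_mx) (gin_mon A b) /\
  homogeneous (mon_degree (gin_mon A b)) (\det form_mx).
Proof.
move=> [[tau_refl _ tau_trans _] _ tauD tau_var].
have supp u : u \in msupp (\det form_mx) -> exists f : {ffun 'I_m -> 'I_n},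
    \det (\matrix_(i, j) e i j (f j)) != 0 /\ u = gin_mon A f.
  rewrite det_form_mx => /msupp_sum_le /flattenP[_ /mapP[f _ ->]] uf.
  exists f; have -> : u = gin_mon A f.
    by move/msuppZ_le: uf; rewrite msuppX inE => /eqP.
  split=> //; apply: contraTneq uf => ->; by rewrite scale0r msupp0.
split; last first.
  by move=> u /supp[f [_ ->]]; rewrite !gin_mon_degree.
split=> [|u /supp[f [/det_form_mx_coef0[fb _] ->]]]; last first.
  rewrite /gin_mon; apply: (big_ind2 (fun x y => tau x y)) => // [x x' y y' xx yy|i iA].
    apply: tau_trans (tauD _ _ y xx) _; rewrite [(x' + y)%MM]addmC [(x' + y')%MM]addmC.
    exact: tauD.
  have := fb i iA; rewrite leq_eqVlt => /orP[/eqP bf|]; last exact: tau_var.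
  by rewrite (_ : b i = f i) //; apply: val_inj.
rewrite mcoeff_msupp det_form_mx raddf_sum /= (bigD1 [ffun i => b i]) //=.
rewrite big1 => [|f fb]; last first.
  rewrite mcoeffZ mcoeffX; case: eqP => [eq_mon|]; last by rewrite mulr0.
  have [->|/det_form_mx_coef0[_ fbA]] := eqVneq (\det (\matrix_(i, j) e i j (f j))) 0.
    by rewrite mul0r.
  case/eqP: fb; apply/ffunP => i; rewrite ffunE.
  have [iA|/fbA //] := boolP (i \in A).
  have := congr1 (fun u : mon => u (mxvec_index i (f i))) eq_mon.
  by rewrite /= !gin_monE iA eqxx /=; case: eqP.
rewrite addr0 mcoeffZ (_ : \matrix_(i, j) _ = 1%:M).
  rewrite det1 mul1r mcoeffX (_ : gin_mon A _ = gin_mon A b) ?eqxx ?oner_neq0 //.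
  by apply: eq_bigr => i _; rewrite ffunE.
apply/matrixP => i j; rewrite !mxE ffunE /e eqxx andbT.
case: ifPn => jA //; case: ifPn => iA; first by rewrite c_b ?eqxx ?andbT.
by case: eqP => // ij; rewrite ij jA in iA.
Qed.

End LeadingTerm.

Section MinorsIdeal.
Variables (m n : nat) (K : fieldType).
Local Notation S := {mpoly K[m * n]}.
Local Notation mon := 'X_{1.. m * n}.
Local Notation degree := {ffun 'I_m -> nat}.
Variable L : 'M[S]_(m, n).
Hypothesis hL : forall i j, homogeneous (unit_degree i) (L i j).
Local Notation I2 := (minors_ideal 2 L).

Definition coef_mx i : 'M[K]_n := \matrix_(j, k) (L i j)@_U_(mxvec_index i k).

Lemma mem_relspace_coef i v : (v \in relspace L i) = (v *m coef_mx i == 0).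
Proof. by rewrite memv_ker lfunE. Qed.

(** The two rows and the two columns can be taken in any order. *)
Lemma minor2_mem i i' k l : i != i' -> I2 (L i k * L i' l - L i l * L i' k).
Proof.
have Iid := gen_ideal_is_ideal (minor_of 2 L).
have lt_mem (p p' : 'I_m) (q q' : 'I_n) : (p < p')%N -> (q < q')%N ->
    I2 (L p q * L p' q' - L p q' * L p' q).
  move=> pp qq; apply: mem_gen_ideal.
  exists (fun a : 'I_2 => if a == 0 then p else p'), (fun a : 'I_2 => if a == 0 then q else q').
  split; first by move=> [[|[|k']] ?] [[|[|l']] ?].
    by move=> [[|[|k']] ?] [[|[|l']] ?].
  by rewrite det_mx22 !mxE.
have I0 : I2 0 by case: Iid.
move=> ii; wlog lt_kl : k l / (k < l)%N => [W|].
  have [kl|lk|kl] := ltngtP k l; first exact: W.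
    by rewrite -opprB; apply: idealN => //; apply: W.
  by rewrite (val_inj kl) subrr.
have [i_lt|i_gt|iE] := ltngtP i i'; first exact: lt_mem.
  have := idealN Iid (lt_mem _ _ _ _ i_gt lt_kl).
  by rewrite opprB [X in X - _]mulrC [X in _ - X]mulrC.
by rewrite (val_inj iE) eqxx in ii.
Qed.

Definition row_form i (v : 'rV[K]_n) : S := \sum_j v 0 j *: L i j.

Lemma row_form_sum i (T : Type) (r : seq T) (P : pred T) (F : T -> 'rV[K]_n) :
  row_form i (\sum_(a <- r | P a) F a) = \sum_(a <- r | P a) row_form i (F a).
Proof.
rewrite exchange_big; apply: eq_bigr => j _ /=.
by rewrite summxE scaler_suml.
Qed.

Lemma row_formN i v : row_form i (- v) = - row_form i v.
Proof. by rewrite -sumrN; apply: eq_bigr => j _; rewrite mxE scaleNr. Qed.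

Lemma row_form_minor i i' v v' : i != i' ->
  I2 (row_form i v * row_form i' v' - row_form i v' * row_form i' v).
Proof.
move=> ii; rewrite /row_form.
have -> : (\sum_j v 0 j *: L i j) * (\sum_j v' 0 j *: L i' j) -
    (\sum_j v' 0 j *: L i j) * (\sum_j v 0 j *: L i' j) =
    \sum_k \sum_l (v 0 k * v' 0 l)%:MP * (L i k * L i' l - L i l * L i' k).
  rewrite !mulr_suml [X in _ - X](eq_bigr (fun l => \sum_k (v 0 k * v' 0 l) *: (L i l * L i' k))).
    rewrite exchange_big -sumrB; apply: eq_bigr => k _ /=.
    rewrite mulr_sumr -sumrB; apply: eq_bigr => l _.
    by rewrite -scalerAl -scalerAr scalerA -scalerBr mul_mpolyC.
  move=> l _; rewrite mulr_sumr; apply: eq_bigr => k _.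
  by rewrite -scalerAl -scalerAr scalerA mulrC.
have Iid := gen_ideal_is_ideal (minor_of 2 L).
apply: ideal_sum => // k _; apply: ideal_sum => // l _.
by case: (Iid) => _ _; apply; apply: minor2_mem.
Qed.

Definition row_form_mx (A : {set 'I_m}) (N : 'I_m -> 'I_m -> 'rV[K]_n) : 'M[S]_m :=
  \matrix_(i, j) if (i \in A) && (j \in A) then row_form j (N i j) else (i == j)%:R.

(** As the rows of N sum to 0, the column j0 is minus the sum of the columns obtained
by evaluating the other columns of N on row j0.  In each resulting determinant,
two columns are the evaluations of the same vectors on two rows of L. *)
Lemma det_row_form_mx_mem (A : {set 'I_m}) N : A != set0 ->
  (forall i, i \in A -> \sum_(j in A) N i j = 0) -> I2 (\det (row_form_mx A N)).
Proof.
move=> /set0Pn[j0 j0A] sumN; set D := row_form_mx A N.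
have Iid := gen_ideal_is_ideal (minor_of 2 L).
pose E j i := if i \in A then row_form j0 (N i j) else 0.
pose Dj j : 'M[S]_m := \matrix_(i, k) if k == j0 then E j i else D i k.
have detDj j : \det (Dj j) = \sum_i E j i * cofactor D i j0.
  rewrite (expand_det_col _ j0); apply: eq_bigr => i _; rewrite mxE eqxx.
  rewrite /cofactor; congr (_ * (_ * \det _)); apply/matrixP => a c.
  by rewrite !mxE eq_sym (negPf (neq_lift _ _)).
have -> : \det D = - \sum_(j in A | j != j0) \det (Dj j).
  under eq_bigr => j _ do rewrite detDj.
  rewrite exchange_big -sumrN (expand_det_col _ j0); apply: eq_bigr => i _ /=.
  rewrite -mulr_suml -mulNr; congr (_ * _); rewrite mxE j0A andbT /E.
  case: ifPn => iA; last first.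
    rewrite big1 ?oppr0 //; case: eqP => // ij; by rewrite ij j0A in iA.
  have := sumN i iA; rewrite (bigD1 j0) //= => /eqP; rewrite addr_eq0 => /eqP ->.
  by rewrite row_formN row_form_sum.
apply: idealN => //; apply: ideal_sum => // j /andP[jA jj0].
apply: (det_two_columns (j0 := j0) (j1 := j)) => //; first by rewrite eq_sym.
move=> i i'; rewrite !mxE eqxx (negPf jj0) jA /E !andbT.
have I0 : I2 0 by case: Iid.
have [iA|iA] := boolP (i \in A); have [iA'|iA'] := boolP (i' \in A) => //.
- by apply: row_form_minor; rewrite eq_sym.
- rewrite mul0r subr0; case: eqP => [ij|_]; last by rewrite mulr0.
  by rewrite ij jA in iA'.
- rewrite mul0r sub0r; case: eqP => [ij|_]; last by rewrite mulr0 oppr0.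
  by rewrite ij jA in iA.
- by rewrite !mul0r subrr.
Qed.

Lemma act_entry g i j :
  act g (L i j) = \sum_h moved coef_mx g i j h *: xvar K i h.
Proof.
rewrite {1}(linear_formE (@hL i j)) act_sum.
under eq_bigr => k _ do rewrite actZ act_xvar scaler_sumr.
rewrite exchange_big; apply: eq_bigr => h _ /=.
rewrite mxE scaler_suml; apply: eq_bigr => k _.
by rewrite scalerA !mxE.
Qed.

Lemma act_row_form g i v : act g (row_form i v) =
  \sum_h (v *m moved coef_mx g i) 0 h *: xvar K i h.
Proof.
rewrite act_sum.
under eq_bigr => j _ do rewrite actZ act_entry scaler_sumr.
rewrite exchange_big; apply: eq_bigr => h _ /=.
rewrite mxE scaler_suml; apply: eq_bigr => j _.
by rewrite scalerA.
Qed.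

Lemma act_row_form_mx g A N :
  map_mx (act g) (row_form_mx A N) =
  form_mx A (fun i j h => (N i j *m moved coef_mx g j) 0 h).
Proof.
apply/matrixP => i j; rewrite !mxE; case: ifP => _; first exact: act_row_form.
by case: (i == j); rewrite ?act1 ?act0.
Qed.

Lemma act_row_form_at g i v (X : 'M[K]_(m, n)) :
  (act g (row_form i v)).@[at_point X] =
  (v *m (row i X *m (moved coef_mx g i)^T)^T) 0 0.
Proof.
rewrite act_row_form raddf_sum; move: (moved _ _ _) => M.
rewrite trmx_mul trmxK mulmxA mxE; apply: eq_bigr => h _ /=.
by rewrite mevalZ mevalXU /at_point mxvecE [(row i X)^T _ _]mxE [row i X _ _]mxE.
Qed.

(** At a point of the locus the matrix L takes a value of rank at most 1. *)
Lemma minors_vanish g A f :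
  act_ideal g I2 f -> vanishes (moved coef_mx g) A f.
Proof.
move=> [f0 If ->] X [z zE].
pose I h := (act g h).@[at_point X] = 0.
have Iid : is_ideal I.
  split=> [|h h' Ih Ih'|h h' Ih']; rewrite /I.
  - by rewrite act0 meval0.
  - by rewrite actD mevalD Ih Ih' addr0.
  - by rewrite actM mevalM Ih' mulr0.
apply: (gen_ideal_min Iid _ If) => _ [p [q [_ _ ->]]].
have LX i j : (act g (L i j)).@[at_point X] = (if i \in A then z else 0) 0 j.
  have -> : L i j = row_form i (delta_mx 0 j).
    rewrite /row_form (bigD1 j) //= mxE !eqxx scale1r big1 ?addr0 // => k kj.
    by rewrite mxE (negPf kj) andbF scale0r.
  by rewrite act_row_form_at zE -rowE !mxE.
have tX : (act g (\det (mxsub p q L))).@[at_point X] = 0; last exact: tX.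
rewrite det_mx22 actB !actM !mxE mevalB !mevalM !LX.
by case: ifP => _; case: ifP => _; rewrite ?mxE ?mulr0 ?mul0r ?subrr // mulrC subrr.
Qed.

Hypothesis K_inf : infinite_field K.
Variable g : 'I_m -> 'M[K]_n.
Local Notation V := (relspace L).
Local Notation B := (moved coef_mx g).
Local Notation w := (codim_sum V).
Local Notation d i := (w [set i]).
Hypothesis indep : independent_columns V B.
Hypothesis spans : spanning_flags V B.
Hypothesis n_gt0 : (0 < n)%N.

Lemma relspace_moved i v : v \in V i -> v *m B i = 0.
Proof. by move=> vV; apply: mulmx_moved_eq0 vV; apply: mem_relspace_coef. Qed.

(** At a point of the locus, row j of L is the constant vector z for j in A and 0
otherwise; hence the determinant is that of the numbers N_ij z, and its rows sum
to 0 because z is orthogonal to V_A. *)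
Lemma det_row_form_mx_vanishes (A A' : {set 'I_m}) N : A' != set0 ->
  (forall i, i \in A' -> \sum_(j in A' :&: A) N i j \in (\sum_(k in A) V k)%VS) ->
  vanishes B A (act g (\det (row_form_mx A' N))).
Proof.
move=> /set0Pn[j0 j0A] sumN X [z zE].
have Vz v : v \in (\sum_(k in A) V k)%VS -> v *m z^T = 0.
  case/memv_sumP => vs vsV ->; rewrite mulmx_suml big1 // => k kA.
  have := zE k; rewrite kA => <-.
  by rewrite trmx_mul trmxK mulmxA relspace_moved ?mul0mx // vsV.
rewrite act_det act_row_form_mx -det_map_mx; apply/eqP.
rewrite -det_tr; apply/det0P; exists (\row_j (j \in A')%:R).
  apply/negP => /eqP /(congr1 (fun M : 'rV_m => M 0 j0)); rewrite !mxE j0A => /eqP.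
  by rewrite oner_eq0.
apply/rowP => i; rewrite !mxE.
have [iA|iA] := boolP (i \in A'); last first.
  rewrite big1 // => j _; rewrite !mxE (negPf iA) /=; case: eqP => [<-|_].
    by rewrite (negPf iA) mul0r.
  by rewrite meval0 mulr0.
transitivity ((\sum_(j in A' :&: A) N i j *m z^T) 0 0); last first.
  by rewrite -mulmx_suml Vz ?mxE // sumN.
rewrite summxE [RHS]big_mkcond; apply: eq_bigr => j _; rewrite !mxE iA /= inE.
have [jA|jA] := boolP (j \in A'); last by rewrite mul0r.
rewrite mul1r -act_row_form act_row_form_at zE /=; case: (j \in A); first by rewrite mxE.
by rewrite trmx0 mulmx0 mxE.
Qed.

(** The vectors N_ij = delta_ij lambda_i - p_ij.  In the rows of A outside A' the
flag is taken as small as possible, namely V_j, so that the parts of lambda_i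
that are lost there are relations. *)
Lemma exists_syzygy (A A' : {set 'I_m}) (b : 'I_m -> 'I_n) :
  A != set0 -> A' \subset A -> (forall i, i \in A' -> b i < d i)%N ->
  (w A <= \sum_(i in A') (d i - (b i).+1))%N ->
  exists N : 'I_m -> 'I_m -> 'rV[K]_n,
    (forall i, i \in A' -> exists2 v, \sum_(j in A') N i j = \sum_(j in A :\: A') v j
         & forall j, j \in A :\: A' -> v j \in V j) /\
    (forall i j (h : 'I_n), i \in A' -> j \in A' -> (h <= b j)%N ->
       (N i j *m B j) 0 h = ((i == j) && (h == b j))%:R).
Proof.
move=> A0 A'A bd wA; pose bb i := if i \in A' then (b i).+1 else d i.
have full : (\sum_(i in A) flag B i (bb i))%VS = fullv.
  apply: spans => // [i iA|].
    by rewrite /bb; case: ifP => // /bd.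
  rewrite (big_setID A') /= (setIidPr A'A); apply: leq_trans wA _.
  apply: leq_trans _ (leq_addr _ _); apply: leq_sum => i iA'.
  by rewrite /bb iA'.
have lP i : exists l : 'rV[K]_n, i \in A' ->
    forall h : 'I_n, (h <= b i)%N -> (l *m B i) 0 h = (h == b i)%:R.
  have [iA|] := boolP (i \in A'); last by exists 0.
  by have [l lE] := flag_jump indep (bd i iA); exists l.
have [l lE] := fin_all_exists lP.
have pP i : exists p : 'I_m -> 'rV[K]_n,
    (forall j, j \in A -> p j \in flag B j (bb j)) /\ l i = \sum_(j in A) p j.
  have : l i \in (\sum_(i in A) flag B i (bb i))%VS by rewrite full memvf.
  by case/memv_sumP => p pF lp; exists p.
have [p pE] := fin_all_exists pP.
have AA' j : j \in A' -> j \in A by apply: (subsetP A'A).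
exists (fun i j => (if i == j then l i else 0) - p i j); split=> [i iA'|i j h iA' jA' hb].
  exists (p i) => [|j]; last first.
    rewrite inE => /andP[jA' jA]; have := (pE i).1 j jA.
    by rewrite /bb (negPf jA') (flag_max relspace_moved indep).
  rewrite sumrB -big_mkcondr /= (big_pred1 i) => [|j]; last first.
    by rewrite /= eq_sym; case: eqP => [->|]; rewrite ?iA' ?andbF.
  have := (pE i).2; rewrite (big_setID A') /= (setIidPr A'A) => ->.
  by rewrite [X in X - _]addrC addrK.
have pz : (p i j *m B j) 0 h = 0.
  have /flagP : p i j \in flag B j (bb j) by apply: (pE i).1; apply: AA'.
  by apply; rewrite /bb jA' ltnS.
rewrite mulmxBl mxE [X in _ + X]mxE pz subr0; case: eqP => [ij|_].
  by move: hb; rewrite -ij => hb; rewrite lE.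
by rewrite mul0mx mxE.
Qed.

(** The monomials which form a basis of the functions on the component A. *)
Definition standard (A : {set 'I_m}) (u : mon) :=
  [forall i, (i \notin A) ==> (d i <= first_var u i)%N] &&
  (\sum_(i in A) (d i - (first_var u i).+1) < w A)%N.

Lemma leading_det_row_form_mx tau (A : {set 'I_m}) (b : 'I_m -> 'I_n)
    (N : 'I_m -> 'I_m -> 'rV[K]_n) :
  term_order tau ->
  (forall i j (h : 'I_n), i \in A -> j \in A -> (h <= b j)%N ->
       (N i j *m B j) 0 h = ((i == j) && (h == b j))%:R) ->
  leading_mon tau (act g (\det (row_form_mx A N))) (gin_mon A b) /\
  homogeneous (mon_degree (gin_mon A b)) (act g (\det (row_form_mx A N))).
Proof.
move=> tau_to NE; rewrite act_det act_row_form_mx.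
exact: leading_det_form_mx.
Qed.

Lemma leading_in_minors tau A b : term_order tau -> gin_cond w A b ->
  exists p, [/\ act_ideal g I2 p, leading_mon tau p (gin_mon A b)
    & homogeneous (mon_degree (gin_mon A b)) p].
Proof.
move=> tau_to [bd wA].
have A0 : A != set0.
  by apply: contraTneq wA => ->; rewrite codim_sum0 big_set0 -ltnNge.
have [N [sumN NE]] := exists_syzygy A0 (subxx A) bd wA.
have [lead hom] := leading_det_row_form_mx tau_to NE.
exists (act g (\det (row_form_mx A N))); split=> //.
exists (\det (row_form_mx A N)) => //; apply: det_row_form_mx_mem => // i iA.
by have [v -> _] := sumN i iA; rewrite setDv big_set0.
Qed.

(** Either a row outside A contributes the entry of L with the right leading
variable, or the numerical condition provides a determinant supported on the
rows of A in which u has a variable of index less than d_i. *)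
Lemma leading_vanishing tau (A : {set 'I_m}) u : term_order tau -> (0 < w A)%N ->
  ~~ standard A u ->
  exists p, [/\ vanishes B A p, leading_mon tau p u & homogeneous (mon_degree u) p].
Proof.
move=> tau_to wA0 nstd.
suff [A' [b [N [sub A'0 NE sumN]]]] : exists (A' : {set 'I_m}) (b : 'I_m -> 'I_n) N,
   [/\ forall i, i \in A' -> b i = first_var u i :> nat, A' != set0,
       forall i j (h : 'I_n), i \in A' -> j \in A' -> (h <= b j)%N ->
         (N i j *m B j) 0 h = ((i == j) && (h == b j))%:R
     & forall i, i \in A' -> \sum_(j in A' :&: A) N i j \in (\sum_(k in A) V k)%VS].
  have [lead hom] := leading_det_row_form_mx tau_to NE.
  have le_u : (gin_mon A' b <= u)%MM.
    apply/mnm_lepP => q; case/mxvec_indexP: q => i j; rewrite gin_monE.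
    case: andP => //= -[iA' /eqP <-]; rewrite lt0n.
    exact/first_var_neq0/sub.
  have [lead' hom'] := leading_monomial_mul tau_to lead hom le_u.
  exists (act g (\det (row_form_mx A' N)) * 'X_[u - gin_mon A' b]); split=> // X XA.
  by rewrite mevalM (det_row_form_mx_vanishes A'0 sumN XA) mul0r.
pose b i : 'I_n := insubd (Ordinal n_gt0) (first_var u i).
have bE i : (first_var u i < n)%N -> b i = first_var u i :> nat.
  by move=> lt_n; rewrite /b /insubd insubT.
move: nstd; rewrite /standard negb_and => /orP[/forallPn[i]|].
  rewrite negb_imply -ltnNge => /andP[iA lt_d].
  have bi : b i = first_var u i :> nat.
    by apply: bE; apply: leq_trans lt_d _; apply: codim_sum1_le.
  have [|l lE] := flag_jump indep (k := b i) (i := i); first by rewrite bi.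
  exists [set i], b, (fun _ _ => l); split=> [j|||j]; rewrite ?inE.
  - by move/eqP ->.
  - by apply/set0Pn; exists i; rewrite inE.
  - move=> j k h; rewrite !inE => /eqP -> /eqP -> hb; rewrite eqxx; exact: lE.
  - move=> _; rewrite big1 ?mem0v // => k; rewrite !inE => /andP[/eqP -> iA'].
    by rewrite iA' in iA.
rewrite -leqNgt => wA.
pose A' := [set i in A | (first_var u i < d i)%N].
have A'A : A' \subset A by apply/subsetP => i; rewrite inE => /andP[].
have sumA' : (\sum_(i in A) (d i - (first_var u i).+1) =
    \sum_(i in A') (d i - (first_var u i).+1))%N.
  rewrite (big_setID A') /= (setIidPr A'A) [X in (_ + X)%N]big1 ?addn0 // => i.
  by rewrite !inE => /andP[+ iA]; rewrite iA /=; lia.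
have bE' i : i \in A' -> b i = first_var u i :> nat.
  rewrite inE => /andP[_ lt_d]; apply: bE.
  by apply: leq_trans lt_d _; apply: codim_sum1_le.
have A'0 : A' != set0.
  by apply: contraTneq wA => A'0; rewrite sumA' A'0 big_set0 -ltnNge.
have A0 : A != set0.
  by have [i iA'] := set0Pn _ A'0; apply/set0Pn; exists i; apply: (subsetP A'A).
have [i iA'||N [sumN NE]] := exists_syzygy (b := b) A0 A'A.
- by rewrite bE' //; move: iA'; rewrite inE => /andP[].
- by apply: leq_trans wA _; rewrite sumA'; apply: leq_sum => i iA'; rewrite bE'.
exists A', b, N; split=> // i iA'; rewrite (setIidPl A'A).
have [v -> vV] := sumN i iA'; apply: memv_suml => j jD.
have jA : j \in A by move: jD; rewrite inE => /andP[].
by apply: (subvP (sumv_sup j jA (subvv _))); apply: vV.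
Qed.

Lemma standard_window A u : standard A u -> in_window V A (fun=> n) u.
Proof.
move=> /andP[/forallP offA sumA]; exists (fun i => minn (first_var u i)
  (if i \in A then n.-1 else n)); split=> [i j uij|i iA|i iA|].
- by rewrite ltn_ord andbT; apply: leq_trans (geq_minl _ _) (first_var_ub uij).
- by rewrite iA; apply: leq_ltn_trans (geq_minr _ _) _; rewrite ltn_predL.
- rewrite (negPf iA) geq_minr andbT leq_min codim_sum1_le andbT.
  by have /implyP := offA i; apply.
- apply: leq_ltn_trans sumA; apply: leq_sum => i iA; rewrite iA.
  have dn := codim_sum1_le V i; case: (leqP (first_var u i) n.-1) => [//|_].
  by rewrite prednK // (eqP (_ : d i - n == 0)%N) ?subn_eq0.
Qed.

(** Divide f by the polynomials of [leading_vanishing]: the remainder vanishes on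
the locus and is standard, hence is zero, although the division cannot cancel
a standard leading monomial. *)
Lemma leading_not_standard tau A dg f u : term_order tau -> A != set0 -> (0 < w A)%N ->
  act_ideal g I2 f -> homogeneous dg f -> leading_mon tau f u -> ~~ standard A u.
Proof.
move=> tau_to A0 wA0 If hf [uf fu]; apply/negP => std_u.
have Jid : is_ideal (vanishes B A).
  split=> [X _|p q p0 q0 X XA|p q q0 X XA].
  - by rewrite meval0.
  - by rewrite mevalD p0 ?q0 ?addr0.
  - by rewrite mevalM q0 ?mulr0.
have [p nstd_p|r [hr Jr rstd rE]] := @normal_form m n K tau (vanishes B A)
  (fun u => ~~ standard A u) tau_to Jid _ dg f hf.
  exact: leading_vanishing.
have r0 : r = 0.
  have Vr : vanishes B A r.
    move=> X XA; have := Jr X XA; rewrite mevalB (minors_vanish If XA) sub0r.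
    by move/eqP; rewrite oppr_eq0 => /eqP.
  apply: (@window_eq0 m n K K_inf V B relspace_moved indep spans A A0 _
    (fun=> n) dg r (ltnSn _)) => //.
    by move=> v /rstd; rewrite negbK; apply: standard_window.
  by move=> X XA _; apply: Vr.
move: uf; rewrite mcoeff_msupp -rE ?negbK // r0 mcoeff0 eqxx //.
Qed.

(** A monomial outside M is standard for the set of its active rows, or for any
nonzero row when no row is active. *)
Lemma leading_in_gin tau dg f u : term_order tau -> (exists i, 0 < d i)%N ->
  act_ideal g I2 f -> homogeneous dg f -> leading_mon tau f u -> in_gin w u.
Proof.
move=> tau_to [i0 di0] If hf lead; apply: contraT => nM.
have [R0|R0] := eqVneq (active w u) set0; last first.
  have := leading_not_standard tau_to R0 _ If hf lead.
  rewrite /standard; move: nM; rewrite /in_gin -ltnNge => lt_w.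
  move=> /(_ (leq_ltn_trans (leq0n _) lt_w)); rewrite lt_w andbT => /negP; case.
  by apply/forallP => i; apply/implyP; rewrite inE -leqNgt.
have := leading_not_standard tau_to (A := [set i0]) _ di0 If hf lead.
rewrite /standard big_set1 => /(_ _)/negP; case.
  by apply/set0Pn; exists i0; rewrite inE.
have R i : (d i <= first_var u i)%N.
  by have : i \notin active w u by [rewrite R0 inE]; rewrite inE -leqNgt.
apply/andP; split; first by apply/forallP => i; rewrite R implybT.
by have := R i0; lia.
Qed.

End MinorsIdeal.

(** * The generic initial ideal *)

(** An invertible matrix that maps the span of the last coordinate vectors into
itself maps it onto itself, hence so does its inverse. *)
Lemma invmx_upper_triangular (K : fieldType) n (M : 'M[K]_n) : M \in unitmx ->
  (forall k j : 'I_n, (j < k)%N -> M k j = 0) ->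
  forall k j : 'I_n, (j < k)%N -> invmx M k j = 0.
Proof.
move=> uM Mup k j jk; pose D : 'M[K]_n := diag_mx (\row_l (k <= l)%N%:R).
have DM : D *m M *m D = D *m M.
  rewrite mul_mx_diag; apply/matrixP => a c; rewrite [LHS]mxE [X in _ * X]mxE.
  have [|ck] := leqP k c; rewrite ?mulr1 // mulr0 mul_diag_mx !mxE.
  have [ka|] := leqP k a; last by rewrite mul0r.
  by rewrite mul1r Mup // (leq_trans ck).
have /submxP[X DX] : (D <= D *m M)%MS.
  have sub : (D *m M <= D)%MS by rewrite -DM submxMl.
  by rewrite -(mxrank_leqif_sup sub) mxrankMfree // row_free_unit.
have : row k (D *m invmx M) = row k (X *m D).
  by rewrite {1}DX mulmxA mulmxK.
move=> /(congr1 (fun x : 'rV_n => x 0 j)); rewrite mul_diag_mx mul_mx_diag !mxE.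
by rewrite leqnn mul1r => ->; rewrite leqNgt jk mulr0.
Qed.

Lemma dim_le_n (K : fieldType) n (U : {vspace 'rV[K]_n}) : (\dim U <= n)%N.
Proof. by have := dimvS (subvf U); rewrite dimvf /dim /= mul1n. Qed.

Lemma sum_Posz (I : finType) (A : pred I) (F : I -> nat) :
  \sum_(i | A i) (F i)%:Z = (\sum_(i | A i) F i)%N%:Z.
Proof. by rewrite (big_morph Posz PoszD (erefl _)). Qed.

(** The sum s is kept abstract in the next two lemmas so that they can be applied
up to conversion. *)
Lemma codim_inequality (n x y z t k : nat) (s : int) :
  s = y%:Z -> (z + x + y = k * n)%N -> (t <= n)%N ->
  (n - t <= z)%N <-> x%:Z <= n%:Z * (k%:Z - 1) + t%:Z - s.
Proof.
move=> -> key tn; have -> : n%:Z * (k%:Z - 1) = (k * n)%N%:Z - n%:Z.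
  by rewrite mulrBr mulr1 mulnC PoszM.
by rewrite -key; split; lia.
Qed.

Lemma codim_equality (n x y z t k p : nat) (s : int) :
  s = y%:Z -> (z + p + x + y = k * n)%N -> (t <= n)%N ->
  (z.+1 = n - t)%N <-> x%:Z = n%:Z * (k%:Z - 1) + 1 - p%:Z + t%:Z - s.
Proof.
move=> -> key tn; have -> : n%:Z * (k%:Z - 1) = (k * n)%N%:Z - n%:Z.
  by rewrite mulrBr mulr1 mulnC PoszM.
by rewrite -key; split; lia.
Qed.

Section Assembly.
Variables (m n : nat) (K : fieldType).
Hypothesis n_gt0 : (0 < n)%N.
Hypothesis K_inf : infinite_field K.
Local Notation S := {mpoly K[m * n]}.
Local Notation mon := 'X_{1.. m * n}.
Local Notation degree := {ffun 'I_m -> nat}.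
Variable L : 'M[S]_(m, n).
Hypothesis hL : forall i j, homogeneous (unit_degree i) (L i j).
Local Notation I2 := (minors_ideal 2 L).
Local Notation V := (relspace L).
Local Notation w := (codim_sum V).
Local Notation d i := (w [set i]).

Definition gin_gen (p : S) : Prop := exists A b, gin_cond w A b /\ p = 'X_[gin_mon A b].

Definition gin_ideal := gen_ideal gin_gen.

Lemma gin_idealP f : gin_ideal f <-> {in msupp f, forall u, in_gin w u}.
Proof.
have wa := @codim_sum_anti m n K V; have w0 := codim_sum0 V.
apply: mem_monomial_ideal => [p [A [b [Ab ->]]]|u u'|u].
- by exists (gin_mon A b) => //; apply: (gin_cond_in_gin wa Ab); apply: lepm_refl.
- exact: (in_gin_up wa w0 n_gt0).
- move=> /(in_gin_cond wa w0 n_gt0)[A [b [Ab le_u]]].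
  by exists (gin_mon A b) => //; exists A, b.
Qed.

Lemma gin_ideal_is_ideal : is_ideal gin_ideal.
Proof. exact: gen_ideal_is_ideal. Qed.

Lemma gin_ideal_multigraded : multigraded gin_ideal.
Proof.
apply: multigraded_gen => p [A [b [_ ->]]]; exists (mon_degree (gin_mon A b)).
exact: homogeneousX.
Qed.

Lemma minors_multigraded : multigraded I2.
Proof.
apply: multigraded_gen => p [a [b [_ _ ->]]].
exists (add_degree (unit_degree (a 0)) (unit_degree (a 1))).
by rewrite det_mx22 !mxE; apply: homogeneousB; apply: homogeneousM.
Qed.

(** A Borel element replaces a variable by variables of smaller index in the same
row, and the condition on the generators is stable under decreasing indices. *)
Lemma gin_ideal_act_sub g f : in_borel g -> gin_ideal f -> gin_ideal (act g f).
Proof.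
move=> [_ gB] fM; pose I h := gin_ideal (act g h).
have [M0 MD MM] := gin_ideal_is_ideal.
have Iid : is_ideal I.
  split=> [|h h'|h h']; rewrite /I ?act0 ?actD ?actM //; [exact: MD|exact: MM].
apply: (gen_ideal_min Iid _ fM) => _ [A [b [[bd wA] ->]]]; rewrite /I.
have -> : act g 'X_[gin_mon A b] = \prod_(i in A) \sum_(k < n | (k <= b i)%N)
    g i k (b i) *: xvar K i k.
  rewrite /gin_mon -mprodXE act_prod; apply: eq_bigr => i _.
  rewrite -[X in act g X]/(xvar K i (b i)) act_xvar [RHS]big_mkcond /=.
  by apply: eq_bigr => k _; case: leqP => // /gB ->; rewrite scale0r.
rewrite (big_distr_big_dep (Ordinal n_gt0)) /=; apply: ideal_sum => // c /pfamilyP[_ cb].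
rewrite scaler_prod mprodXE -mul_mpolyC; apply: MM; apply: mem_gen_ideal.
exists A, c; split=> //; split=> [i iA|]; last first.
  apply: leq_trans wA _; apply: leq_sum => i iA; rewrite leq_sub2l // ltnS.
  exact: (cb i iA).
by apply: leq_ltn_trans (bd i iA); apply: (cb i iA).
Qed.

Lemma gin_ideal_borel_fixed : borel_fixed gin_ideal.
Proof.
move=> g gB f; have [gG gup] := gB; split=> [[h hM ->]|fM]; first exact: gin_ideal_act_sub.
exists (act (fun i => invmx (g i)) f); last by rewrite actVK.
apply: gin_ideal_act_sub => //; split=> [i|i]; first by rewrite unitmx_inv.
by apply: invmx_upper_triangular => [|k j]; [apply: gG | apply: gup].
Qed.

(** If all d_i are 0 then M is zero although no component is available; this is the
case of the zero matrix. *)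
Lemma codim_eq0_L : (forall i, d i = 0%N) -> L = 0.
Proof.
move=> d0; apply/matrixP => i j; rewrite mxE.
have Vi : V i = fullv.
  apply/eqP; rewrite eqEdim subvf dimvf /dim /= mul1n.
  by have := d0 i; rewrite codim_sum1 => /eqP.
have : delta_mx 0 j \in V i by rewrite Vi memvf.
rewrite mem_relspace // (bigD1 j) //= mxE !eqxx scale1r big1 ?addr0 => [/eqP //|k kj].
by rewrite mxE (negPf kj) andbF scale0r.
Qed.

Lemma minors_of_zero f : L = 0 -> I2 f -> f = 0.
Proof.
move=> L0 [k [c [q [qm ->]]]]; apply: big1 => a _.
by have [x [y [_ _ ->]]] := qm a; rewrite det_mx22 !mxE L0 !mxE mulr0 subrr mulr0.
Qed.

Lemma some_codim_gt0 : L <> 0 -> exists i, (0 < d i)%N.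
Proof.
move=> L0; apply/existsP; apply: contraT => /existsPn d0; case: L0.
by apply: codim_eq0_L => i; apply/eqP; rewrite -leqn0 leqNgt.
Qed.

Lemma leading_in_gin_ideal g tau dg f u :
  independent_columns V (moved (coef_mx L) g) -> spanning_flags V (moved (coef_mx L) g) ->
  term_order tau -> act_ideal g I2 f -> homogeneous dg f -> leading_mon tau f u ->
  in_gin w u.
Proof.
move=> indep spans tau_to If hf lead.
have [/existsP dpos|/existsPn d0] := boolP [exists i, (0 < d i)%N].
  exact: (leading_in_gin hL K_inf indep spans n_gt0 tau_to dpos If hf lead).
have L0 : L = 0 by apply: codim_eq0_L => i; apply/eqP; rewrite -leqn0 leqNgt.
by case: If lead => h /(minors_of_zero L0) -> ->; rewrite act0 => -[]; rewrite msupp0.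
Qed.

Lemma initial_ideal_moved g tau :
  in_G g ->
  independent_columns V (moved (coef_mx L) g) -> spanning_flags V (moved (coef_mx L) g) ->
  term_order tau -> same_set (initial_ideal tau (act_ideal g I2)) gin_ideal.
Proof.
move=> gG indep spans tau_to f; split=> Ef.
  apply: (gen_ideal_min gin_ideal_is_ideal _ Ef) => _ [h [u [Ih lead ->]]].
  apply/gin_idealP => v; rewrite msuppX inE => /eqP ->.
  have [_ homI] := multigraded_act gG minors_multigraded.
  apply: (leading_in_gin_ideal indep spans tau_to (homI _ (mon_degree u) Ih)) => //.
    exact: hom_component_homogeneous.
  exact: leading_hom_component.
apply: (gen_ideal_min _ _ Ef); first exact: gen_ideal_is_ideal.
move=> _ [A [b [Ab ->]]].
have [p [Ip lead _]] := leading_in_minors hL indep spans n_gt0 tau_to Ab.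
by apply: mem_gen_ideal; exists p, (gin_mon A b).
Qed.

Lemma complements_gin : complements (in_gin w) gin_ideal.
Proof.
have tau_to := @monomial_order_is_term_order m n.
split=> [dg f hf|dg f _ /gin_idealP fM fnM]; last first.
  apply: msuppnil0; case E : (msupp f) => [//|u s].
  have uf : u \in msupp f by rewrite E mem_head.
  by have := fnM u uf; rewrite (fM u uf).
have lead u : in_gin w u -> exists p : S, [/\ gin_ideal p,
    leading_mon (fun u w : mon => (u <= w)%O) p u & homogeneous (mon_degree u) p].
  move=> uM; exists 'X_[u]; split; last exact: homogeneousX.
    by apply/gin_idealP => v; rewrite msuppX inE => /eqP ->.
  by split=> [|v]; rewrite msuppX inE // => /eqP ->; apply: lexx.
by have [r [hr Jr rP _]] := normal_form tau_to gin_ideal_is_ideal lead hf; exists r.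
Qed.

Lemma complements_moved g : in_G g ->
  independent_columns V (moved (coef_mx L) g) -> spanning_flags V (moved (coef_mx L) g) ->
  complements (in_gin w) (act_ideal g I2).
Proof.
move=> gG indep spans; have tau_to := @monomial_order_is_term_order m n.
have Iid := act_ideal_is_ideal gG (gen_ideal_is_ideal (minor_of 2 L)).
split=> [dg f hf|dg f hf If fnM]; last first.
  apply/eqP; apply: contraT => f0; have lf := mlead_supp f0.
  have := fnM _ lf; rewrite (leading_in_gin_ideal indep spans tau_to If hf) //.
  by split=> // v; apply: msupp_le_mlead.
have lead u : in_gin w u -> exists p : S, [/\ act_ideal g I2 p,
    leading_mon (fun u w : mon => (u <= w)%O) p u & homogeneous (mon_degree u) p].
  move=> uM; have wa := @codim_sum_anti m n K V.
  have [A [b [Ab le_u]]] := in_gin_cond wa (codim_sum0 V) n_gt0 uM.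
  have [p [Ip leadp hp]] := leading_in_minors hL indep spans n_gt0 tau_to Ab.
  have [lead' hp'] := leading_monomial_mul tau_to leadp hp le_u.
  exists (p * 'X_[u - gin_mon A b]); split=> //.
  by rewrite mulrC; case: Iid => _ _; apply.
by have [r [hr Jr rP _]] := normal_form tau_to Iid lead hf; exists r.
Qed.

Lemma gin_ideal_decomposition : (exists i, 0 < d i)%N \/ n = 1%N ->
  forall f, gin_ideal f <-> forall v, facet w v -> @P_ideal m n K v f.
Proof.
move=> dn f; have wa := @codim_sum_anti m n K V; have w0 := codim_sum0 V.
rewrite gin_idealP; split=> [fM v fv|fP u uf].
  by apply/P_idealP => u /fM; apply: (facet_in_gin wa w0 fv).
apply: contraT => nM; have [v [fv av]] := facet_cover wa w0 nM dn.
by have /P_idealP/(_ u uf) := fP v fv; rewrite av.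
Qed.

Lemma gin_ideal_radical : radical_ideal gin_ideal.
Proof.
split=> [|f k fkM]; first exact: gin_ideal_is_ideal.
have [/existsP dpos|/existsPn d0] := boolP [exists i, (0 < d i)%N].
  have dec := gin_ideal_decomposition (or_introl dpos).
  apply/dec => v fv; apply: (prime_ideal_radical (k := k)); first exact: P_ideal_prime.
  by apply: (iffLR (dec _) fkM).
have noM u : in_gin w u = false.
  have R0 : active w u = set0.
    apply/setP => i; rewrite [LHS]inE [RHS]inE; apply/negbTE.
    by rewrite -leqNgt; apply: leq_trans (leq0n _); rewrite leqNgt; apply: d0.
  by rewrite /in_gin R0 big_set0 codim_sum0 leqNgt n_gt0.
have zero h : gin_ideal h -> h = 0.
  move/gin_idealP => hM; apply: msuppnil0; case E : (msupp h) => [//|u s].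
  by have := hM u; rewrite E mem_head noM => /(_ isT).
have /eqP := zero _ fkM; rewrite expf_eq0 => /andP[_ /eqP ->].
by case: gin_ideal_is_ideal.
Qed.

Lemma generic_position_open : exists U,
  [/\ zariski_open_in_G U, exists g : 'I_m -> 'M[K]_n, U g
    & forall g, U g -> [/\ in_G g, independent_columns V (moved (coef_mx L) g)
                          & spanning_flags V (moved (coef_mx L) g)]].
Proof.
have memV := @mem_relspace_coef m n K L.
have [U [Uo Un UP]] := generic_open K_inf (generic_and
  (generic_independent_columns memV) (generic_spanning_flags memV)).
by exists U; split=> // g /UP[gG [? ?]].
Qed.

Lemma minors_cartwright_sturmfels : cartwright_sturmfels I2.
Proof.
split; first exact: minors_multigraded.
exists gin_ideal; split.
- exact: gin_ideal_multigraded.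
- exact: gin_ideal_radical.
- exact: gin_ideal_borel_fixed.
have [U [_ [g Ug] /(_ g Ug)[gG indep spans]]] := generic_position_open.
apply: (@same_hilbert_series_complements m n K (in_gin w) g) => //.
- exact: gen_ideal_is_ideal.
- exact: gin_ideal_is_ideal.
- exact: complements_moved.
- exact: complements_gin.
Qed.

Lemma minors_gin tau : term_order tau -> is_gin tau I2 gin_ideal.
Proof.
move=> tau_to; have [U [Uo Un UP]] := generic_position_open.
by exists U; split=> // g /UP[gG indep spans]; apply: initial_ideal_moved.
Qed.

(** The product of the largest variables outside P_v0, one in each row, lies in every
other P_v by incomparability. *)
Lemma gin_ideal_irredundant v0 : facet w v0 ->
  ~ same_set gin_ideal (bigcap_ideal (fun v => facet w v /\ v <> v0)
       (fun v => @P_ideal m n K v)).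
Proof.
have wa := @codim_sum_anti m n K V; have w0 := codim_sum0 V.
move=> fv0 eqM.
pose b i : 'I_n := insubd (Ordinal n_gt0) (v0 i).
have bE i : (v0 i < n)%N -> b i = v0 i :> nat by move=> lt_n; rewrite /b /insubd insubT.
pose u := gin_mon [set i | (v0 i < n)%N] b.
have v0u : avoids v0 u.
  apply/forallP => i; apply/forallP => j; apply/implyP => jv; rewrite gin_monE inE.
  case: leqP => //= lt_n; rewrite eqb0; apply: contraTneq jv => <-.
  by rewrite bE // ltnn.
have : @P_ideal m n K v0 'X_[u].
  have uM : gin_ideal 'X_[u].
    apply/eqM => v [fv vv0]; apply/P_idealP => u'; rewrite msuppX inE => /eqP ->.
    apply/negP => vu; case: vv0; apply: (facet_antichain fv fv0) => i.
    rewrite leqNgt; apply/negP => lt_v.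
    have lt_n : (v0 i < n)%N.
      by apply: leq_trans lt_v _; case: fv => vd _ _; apply: leq_trans (vd i) (codim_sum1_le _ _).
    have /forallP/(_ i)/forallP/(_ (b i)) := vu.
    by rewrite bE // lt_v gin_monE inE lt_n eqxx.
  move/gin_idealP: uM => uM; apply/P_idealP => u' /uM; exact: (facet_in_gin wa w0 fv0).
by move/P_idealP/(_ u); rewrite msuppX mem_head v0u => /(_ isT).
Qed.

Lemma gin_condE (A : {set 'I_m}) (b : 'I_m -> 'I_n) :
  gin_cond w A b <->
  (forall i, i \in A -> ((b i).+1 <= n - \dim (V i))%N) /\
  (\sum_(i in A) (b i).+1)%:Z <=
    n%:Z * (#|A|%:Z - 1) + (\dim (\sum_(i in A) V i)%VS)%:Z
      - \sum_(i in A) (\dim (V i))%:Z.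
Proof.
have bdE : (forall i, i \in A -> b i < d i)%N <->
    (forall i, i \in A -> ((b i).+1 <= n - \dim (V i))%N).
  by split=> bd i iA; have := bd i iA; rewrite codim_sum1.
rewrite /gin_cond bdE; have [bd|nbd] := boolP [forall i in A, (b i).+1 <= n - \dim (V i)]%N;
  last by split=> -[bd _]; case/negP: nbd; apply/forall_inP.
have key : (\sum_(i in A) (d i - (b i).+1) + \sum_(i in A) (b i).+1 +
    \sum_(i in A) \dim (V i) = #|A| * n)%N.
  rewrite -!big_split /= -sum_nat_const; apply: eq_bigr => i iA.
  by have := forall_inP bd i iA; rewrite codim_sum1 => bi; rewrite subnK // subnK ?dim_le_n.
have ineq := codim_inequality (sum_Posz _ _) key (dim_le_n _).
by split=> -[h1 h2]; split=> //; apply/ineq.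
Qed.

Lemma facetE (v : {ffun 'I_m -> nat}) :
  let short (v : {ffun 'I_m -> nat}) := [set i | (v i < n - \dim (V i))%N] in
  facet w v <->
  [/\ forall i, (v i <= n - \dim (V i))%N,
      (\sum_(i < m) v i)%:Z =
        n%:Z * (m%:Z - 1) + 1 - #|short v|%:Z
          + (\dim (\sum_(i in short v) V i)%VS)%:Z - \sum_(i < m) (\dim (V i))%:Z
    & forall B : {set 'I_m}, short v \proper B ->
        (\dim (\sum_(i in short v) V i)%VS < \dim (\sum_(i in B) V i)%VS)%N].
Proof.
move=> sh; have shE : short w v = sh v by apply/setP => i; rewrite !inE codim_sum1.
have boundE : (forall i, v i <= d i)%N <-> (forall i, v i <= n - \dim (V i))%N.
  by split=> vd i; have := vd i; rewrite codim_sum1.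
have closedE : (forall B : {set 'I_m}, short w v \proper B -> w B < w (short w v))%N <->
  (forall B : {set 'I_m}, sh v \proper B ->
    (\dim (\sum_(i in sh v) V i)%VS < \dim (\sum_(i in B) V i)%VS)%N).
  rewrite shE; split=> cl B /cl; rewrite /codim_sum.
    by rewrite ltnNge => h; rewrite ltnNge; apply: contra h; apply: leq_sub2l.
  by move=> lt_dim; rewrite ltn_sub2l // (leq_trans lt_dim) // dim_le_n.
have sumE : (forall i, v i <= d i)%N ->
  (\sum_(i in short w v) (d i - (v i).+1)).+1 = w (short w v) <->
  (\sum_(i < m) v i)%:Z = n%:Z * (m%:Z - 1) + 1 - #|sh v|%:Z
          + (\dim (\sum_(i in sh v) V i)%VS)%:Z - \sum_(i < m) (\dim (V i))%:Z.
  move=> vd; have -> : w (short w v) = (n - \dim (\sum_(i in sh v) V i)%VS)%N.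
    by rewrite shE.
  apply: codim_equality (sum_Posz _ _) _ (dim_le_n _).
  rewrite -sum1_card -shE -big_split /= [X in (X + _ + _)%N]big_mkcond /= -!big_split /=.
  rewrite -[X in (X * n)%N]card_ord -sum_nat_const; apply: eq_bigr => i _.
  have := vd i; rewrite inE codim_sum1 => vi; case: ifPn => [lt_v|].
    by rewrite addn1 -subSn // subSS subnK ?subnK ?dim_le_n // ltnW.
  rewrite -leqNgt => dv; have -> : v i = (n - \dim (V i))%N by apply/eqP; rewrite eqn_leq vi.
  by rewrite add0n subnK ?dim_le_n.
split=> [[h1 h2 h3]|[/boundE h1 h2 h3]].
  by split; [apply/boundE | apply/sumE | apply/closedE].
by split=> //; [apply/sumE | apply/closedE].
Qed.

End Assembly.

Theorem theorem5p1 (m n : nat) (hm : (0 < m)%N) (hn : (0 < n)%N)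
    (K : fieldType) (hK : infinite_field K)
    (L : 'M[{mpoly K[m * n]}]_(m, n))
    (hL : forall i j, homogeneous (unit_degree i) (L i j)) :
  let I2 := minors_ideal 2 L in
  let V := relspace L in
  let VV (A : {set 'I_m}) := (\sum_(i in A) V i)%VS in
  let short (v : {ffun 'I_m -> nat}) := [set i | (v i < n - \dim (V i))%N] in
  cartwright_sturmfels I2 /\
  exists gin : {mpoly K[m * n]} -> Prop,
    [/\ forall tau, term_order tau -> is_gin tau I2 gin,
        same_set gin (gen_ideal (fun p =>
          exists (A : {set 'I_m}) (b : 'I_m -> 'I_n),
            [/\ forall i, i \in A -> ((b i).+1 <= n - \dim (V i))%N,
                (\sum_(i in A) (b i).+1)%:Z <=
                  n%:Z * (#|A|%:Z - 1) + (\dim (VV A))%:Z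
                    - \sum_(i in A) (\dim (V i))%:Z
              & p = \prod_(i in A) xvar K i (b i)]))
      & L <> 0 \/ n = 1%N -> irredundant_prime_decomposition
          (fun v : {ffun 'I_m -> nat} =>
            [/\ forall i, (v i <= n - \dim (V i))%N,
                (\sum_(i < m) v i)%:Z =
                  n%:Z * (m%:Z - 1) + 1 - #|short v|%:Z
                    + (\dim (VV (short v)))%:Z - \sum_(i < m) (\dim (V i))%:Z
              & forall B : {set 'I_m}, short v \proper B ->
                  (\dim (VV (short v)) < \dim (VV B))%N])
          (fun v => @P_ideal m n K v) gin].
Proof.
move=> I2 V VV short; split; first exact: minors_cartwright_sturmfels.
exists (gin_ideal L); split.
- by move=> tau; apply: minors_gin.
- move=> f; split=> fM; apply: (gen_ideal_min (gen_ideal_is_ideal _) _ fM).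
    move=> _ [A [b [/gin_condE[bd ineq] ->]]]; apply: mem_gen_ideal.
    by exists A, b; split=> //; rewrite /gin_mon -mprodXE.
  move=> _ [A [b [bd ineq ->]]]; apply: mem_gen_ideal; exists A, b.
  by split; [apply/gin_condE | rewrite /gin_mon -mprodXE].
- move=> Ln.
  have dn : (exists i, 0 < codim_sum V [set i])%N \/ n = 1%N.
    by case: Ln => [L0|]; [left; apply: some_codim_gt0 | right].
  split=> [v _|f|v0 /facetE fv0 eqM].
  + exact: P_ideal_prime.
  + rewrite (gin_ideal_decomposition hn dn); split=> fP v.
      by move/facetE; apply: fP.
    by move/facetE; apply: fP.
  + apply: (gin_ideal_irredundant hn fv0) => f; rewrite eqM.
    split=> fP v [Dv ne]; apply: fP; split=> //; exact/facetE.
Qed.
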